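(* Assume (A1). For all $\epsilon>0$ small enough there exist constants $C<\infty$, $\kappa>0$ and $\tilde c>0$ such that for all $x\in\mathbb{Z}^2$ with $\|x\|_\infty\ge 2$, \[ \mathbb{P}\bigl(\mathcal{R}(0,x)\ge \tilde c\log\|x\|_\infty\bigr)\ge 1-\frac{C}{\|x\|_\infty^{\kappa}}. \]
   Context: Coupling constants $J_{x,y}=J_{x-y}$ with $J_x=J_{-x}\ge0$ and $\sum_{x\in\mathbb{Z}^2}J_x=1$. (A1): there exist $\alpha>4$ and $J\ge0$ such that $J_x\le J\|x\|_1^{-\alpha}$ for all $x\ne0$. Random resistor network on $\mathbb{Z}^2$: independently for each unordered pair $\{x,y\}$ of distinct vertices with $J_{x,y}>0$, the edge is ''shorted'' (resistance $0$) with probability $\epsilon J_{x,y}$, and otherwise has resistance $1/J_{x,y}$ (conductance $J_{x,y}$); $\mathbb{P}$ denotes the law of this random choice. The effective resistance is $\mathcal{R}(0,x)=\mathcal{E}_{\rm eff}^{-1}$, where $\mathcal{E}_{\rm eff}=\inf\{\tfrac12\sum_{u,v}J_{u,v}(g(u)-g(v))^2\}$, the sum running over ordered pairs $(u,v)$ of distinct vertices such that $\{u,v\}$ is not shorted, and the infimum over functions $g:\mathbb{Z}^2\to\mathbb{R}$ with $g(0)=1$, $g(x)=0$ and $g(u)=g(v)$ for every shorted edge $\{u,v\}$ (with $\inf\emptyset=+\infty$, i.e. $\mathcal{R}(0,x)=0$ if $0$ and $x$ are joined by a chain of shorted edges). *)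

(* Defs.v *)
From HB Require Import structures.
From mathcomp Require Import all_boot all_order all_algebra.
From mathcomp Require Import all_classical all_reals all_analysis.
Set Implicit Arguments. Unset Strict Implicit. Unset Printing Implicit Defensive.
Import Order.TTheory GRing.Theory Num.Theory.
Local Open Scope classical_set_scope.
Local Open Scope ring_scope.

Definition Z2 := (int * int)%type.

Definition origin : Z2 := (0%R, 0%R).
Definition zsub (u v : Z2) : Z2 := (u.1 - v.1, u.2 - v.2).
Definition zopp (u : Z2) : Z2 := (- u.1, - u.2).

Definition norm1 (x : Z2) : nat := (`|x.1| + `|x.2|)%N.
Definition norminf (x : Z2) : nat := maxn `|x.1| `|x.2|.

Definition coupling (R : realType) (J : Z2 -> R) : Prop :=
  (forall x, J x = J (zopp x)) /\ (forall x, 0 <= J x) /\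
  (\esum_(x in [set: Z2]) (J x)%:E = 1%E).

Definition A1 (R : realType) (J : Z2 -> R) : Prop :=
  exists alpha : R, 4 < alpha /\ exists Jc : R, 0 <= Jc /\
    forall x : Z2, x != (0, 0) -> J x <= Jc * ((norm1 x)%:R `^ (- alpha)).

(* lexicographic strict order: canonical orientation of an unordered pair *)
Definition lt_lex (u v : Z2) : bool :=
  (u.1 < v.1) || ((u.1 == v.1) && (u.2 < v.2)).

(* [sh u v] = the (unordered) edge {u,v} is shorted.
   Energy of g: 1/2 sum over ordered pairs (u,v), u<>v, {u,v} not shorted,
   of J_{u-v} (g u - g v)^2 (an extended nonnegative real). *)
Definition energy (R : realType) (J : Z2 -> R) (sh : Z2 -> Z2 -> bool)
    (g : Z2 -> R) : \bar R :=
  (2^-1)%:E * \esum_(p in [set p : Z2 * Z2 | p.1 != p.2 /\ ~~ sh p.1 p.2])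
                 (J (zsub p.1 p.2) * (g p.1 - g p.2) ^+ 2)%:E.

(* effective energy (conductance) between a and b; inf of empty set = +oo *)
Definition Eeff (R : realType) (J : Z2 -> R) (sh : Z2 -> Z2 -> bool)
    (a b : Z2) : \bar R :=
  ereal_inf [set energy J sh g | g in
    [set g : Z2 -> R | g a = 1 /\ g b = 0 /\
                       forall u v, sh u v -> g u = g v]].

Definition eresistance (R : realType) (J : Z2 -> R) (sh : Z2 -> Z2 -> bool)
    (a b : Z2) : \bar R :=
  match Eeff J sh a b with
  | EFin r => if r == 0 then +oo%E else (r^-1)%:E
  | +oo%E => 0%E
  | -oo%E => +oo%E
  end.

(* The random resistor network: xi u v w = "edge {u,v} shorted in outcome w";
   symmetric, each event measurable, and the events for distinct unordered
   pairs of distinct vertices are mutually independent with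
   P(edge {u,v} shorted) = eps * J_{u-v}. *)
Definition RRN (R : realType) (J : Z2 -> R) (eps : R)
    (d : measure_display) (T : measurableType d) (P : probability T R)
    (xi : Z2 -> Z2 -> T -> bool) : Prop :=
  (forall u v w, xi u v w = xi v u w) /\
  (forall u v, measurable [set w | xi u v w]) /\
  (forall s : seq (Z2 * Z2), uniq s -> all (fun p => lt_lex p.1 p.2) s ->
     P [set w | all (fun p => xi p.1 p.2 w) s] =
     (\prod_(p <- s) (eps * J (zsub p.1 p.2)))%:E).

(* Main.v *)
(* A shorted cluster is explored by self-avoiding paths, and a path is shorted
   with probability the product of the eps J over its steps. As alpha > 4, the
   sum of J_x (1 + |x|)^r is finite for some r > 2, and (1 + T)^r is
   submultiplicative in the total length T of a path, so for small eps the paths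
   from a given vertex satisfy sum P(path shorted) (1 + T)^r <= 2.
   Let N = |x|_oo and let phi be the logarithmic profile equal to 1 within
   L = N^(1-delta) and to 0 beyond N/2; the test function g is the supremum of phi
   over the shorted cluster. As J is summable, the energy of g is at most a
   constant times that of phi, which is O(1/log N), plus the sum of (g - phi)^2;
   and (g - phi)(u)^2 is O((log N)^-2 max(|u|, L)^-2) times the square of the
   largest T of a shorted path from u. So it suffices that the sum of these squares
   weighted by max(|u|, L)^-2 is O(log N) outside an event of polynomially small
   probability. No path starting within distance N has T > N^(1-2delta), by a union
   bound; the paths with T between n = N^(1/12) and N^(1-2delta) are handled by
   Markov's inequality; those with T <= n by Chebyshev's, since the contributions
   of vertices at distance more than 2n are independent. *)
Require Import Defs.
From HB Require Import structures.
From mathcomp Require Import all_boot all_order all_algebra.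
From mathcomp Require Import all_classical all_reals all_analysis.
From mathcomp Require Import measurable_realfun.
From mathcomp Require Import lra ring zify.
Set Implicit Arguments. Unset Strict Implicit. Unset Printing Implicit Defensive.
Import Order.TTheory GRing.Theory Num.Theory.
Local Open Scope classical_set_scope.
Local Open Scope ring_scope.

(** * Harmonic and power sums *)

Section RealSums.
Context {R : realType}.
Implicit Types s x y : R.

(** This is [ln (1 + x) <= x] at [x = - 1 / (k + 2)]. *)
Lemma ln_succ_ge (k : nat) :
  ((k.+2)%:R)^-1 <= ln (k.+2)%:R - ln (k.+1)%:R :> R.
Proof.
rewrite -ln_div ?posrE ?ltr0n//.
rewrite -[ln _]opprK -lnV ?posrE ?divr_gt0 ?ltr0n// invf_div.
have -> : k.+1%:R / k.+2%:R = 1 + - (k.+2%:R)^-1 :> R.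
  rewrite -[in LHS](natr1 k.+1).
  have k2 : k.+1%:R + 1 != 0 :> R by rewrite natr1 pnatr_eq0.
  by rewrite -(natr1 k.+1); field.
rewrite lerNr; apply: le_ln1Dx.
by rewrite ltrN2 invf_lt1 ?ltr0n// ltr1n.
Qed.

Lemma harmonic_le_ln (n : nat) :
  \sum_(k < n.+1) ((k.+1)%:R)^-1 <= 1 + ln (n.+1)%:R :> R.
Proof.
elim: n => [|n IH]; first by rewrite big_ord1 invr1 ln1 addr0.
rewrite big_ord_recr /=; apply: le_trans (lerD IH (ln_succ_ge n)) _; lra.
Qed.

Lemma powR_sum_le s (n : nat) : 0 < s ->
  \sum_(k < n) ((k.+1)%:R `^ (- (1 + s))) <= 1 + s^-1 :> R.
Proof.
move=> s0; have [->|n0] := posnP n; first by rewrite big_ord0 addr_ge0// invr_ge0 ltW.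
rewrite -(prednK n0); move: n.-1 => {n0}n.
(* The subtracted term is the tail in the comparison with an integral; with it the bound telescopes
   and goes through by induction. *)
suff : \sum_(k < n.+1) ((k.+1)%:R `^ (- (1 + s))) <= 1 + s^-1 - s^-1 * (n.+1)%:R `^ (- s) :> R.
  have : 0 <= s^-1 * (n.+1)%:R `^ (- s) :> R by rewrite mulr_ge0 ?powR_ge0// invr_ge0 ltW.
  lra.
elim: n => [|n IH]; first by rewrite big_ord1 !powR1; lra.
rewrite big_ord_recr /=; apply: le_trans (lerD IH (lexx _)) _.
suff: s * (n.+2)%:R `^ (- (1 + s)) <= (n.+1)%:R `^ (- s) - (n.+2)%:R `^ (- s) :> R.
  rewrite -(ler_pM2l (x := s^-1)) ?invr_gt0// mulKf ?gt_eqF//; lra.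
have n2 : (n.+2)%:R != 0 :> R by rewrite pnatr_eq0.
have -> : (n.+2)%:R `^ (- (1 + s)) = (n.+2)%:R `^ (- s) * (n.+2)%:R^-1 :> R.
  by rewrite opprD addrC powRD ?n2 ?implybT// powR_inv1.
have -> : (n.+1)%:R `^ (- s) = (n.+2)%:R `^ (- s) * expR (s * (ln (n.+2)%:R - ln (n.+1)%:R)) :> R.
  rewrite /powR !pnatr_eq0 /= -expRD; congr expR; ring.
(* Convexity of the exponential replaces the mean value theorem for [x ^ (- s)]. *)
have h := expR_ge1Dx (s * (ln (n.+2)%:R - ln (n.+1)%:R)).
have h2 : s * (n.+2)%:R^-1 <= s * (ln (n.+2)%:R - ln (n.+1)%:R) by rewrite ler_pM2l// ln_succ_ge.
have p0 : 0 <= (n.+2)%:R `^ (- s) :> R by exact: powR_ge0.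
have := ler_wpM2l p0 (le_trans (lerD (lexx 1) h2) h).
move: (_ `^ _) (expR _) (_^-1) => p e q; rewrite mulrDr mulr1 mulrCA; lra.
Qed.

Lemma ln_lip x y : 0 < x -> 0 < y -> ln x - ln y <= (x - y) / y.
Proof.
move=> x0 y0; have y1 : y != 0 by rewrite gt_eqF.
rewrite -ln_div ?posrE//.
have -> : x / y = 1 + (x - y) / y by field.
apply: le_ln1Dx; have -> : (x - y) / y = x / y - 1 by field.
by rewrite ltrBrDl subrr divr_gt0.
Qed.

Lemma ler_sum_subset (I : eqType) (s t : seq I) (F : I -> R) :
  uniq s -> {subset s <= t} -> (forall i, 0 <= F i) ->
  \sum_(i <- s) F i <= \sum_(i <- t) F i.
Proof.
move=> us st F0; elim: s t us st => [|a s IH] t /=.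
  by move=> _ _; rewrite big_nil sumr_ge0.
move=> /andP[as_ us] st.
have at_ : a \in t by apply: st; rewrite mem_head.
rewrite big_cons (perm_big _ (perm_to_rem at_)) big_cons lerD2l.
apply: IH => // i is_.
have : i \in t by apply: st; rewrite inE is_ orbT.
rewrite (perm_mem (perm_to_rem at_)) inE => /orP[/eqP ia|//].
by rewrite -ia is_ in as_.
Qed.

End RealSums.

(** * Norms, balls and spheres of the lattice *)

Lemma norm1_zsubC u v : norm1 (zsub u v) = norm1 (zsub v u).
Proof. by rewrite /norm1 /zsub /=; lia. Qed.

Lemma norm1_triangle u v t : (norm1 (zsub u t) <= norm1 (zsub u v) + norm1 (zsub v t))%N.
Proof. by rewrite /norm1 /zsub /=; lia. Qed.

Lemma norm1_le_zsub u v : (norm1 u <= norm1 (zsub u v) + norm1 v)%N.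
Proof. by rewrite /norm1 /zsub /=; lia. Qed.

Lemma norm1_zsub_eq0 u v : (norm1 (zsub u v) == 0)%N = (u == v).
Proof.
case: u v => [u1 u2] [v1 v2]; rewrite /norm1 /zsub /= xpair_eqE; apply/eqP/andP.
  by move=> h; split; apply/eqP; lia.
by case=> /eqP -> /eqP ->; lia.
Qed.

Lemma norm1_zsub0 u : norm1 (zsub u u) = 0%N.
Proof. by apply/eqP; rewrite norm1_zsub_eq0. Qed.

Lemma zsub_injl v : injective (zsub v).
Proof. by move=> [a b] [c e] [/= h1 h2]; congr pair; lia. Qed.

Lemma zsub_injr v : injective (zsub ^~ v).
Proof. by move=> [a b] [c e] [/= h1 h2]; congr pair; lia. Qed.

Lemma zsubN u v : zsub u v = zopp (zsub v u).
Proof. by rewrite /zsub /zopp /=; congr pair; lia. Qed.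

Lemma norminf_le_norm1 u : (norminf u <= norm1 u)%N.
Proof. by rewrite /norminf /norm1; lia. Qed.

Definition ints (n : nat) : seq int := [seq (Posz i) | i <- iota 0 n.+1] ++ [seq Negz i | i <- iota 0 n].

Definition box (n : nat) : seq Z2 := [seq (i, j) | i <- ints n, j <- ints n].

Definition ball (n : nat) : seq Z2 := undup [seq u <- box n | (norm1 u <= n)%N].

Lemma mem_ints n i : (i \in ints n) = (`|i| <= n)%N.
Proof.
rewrite /ints mem_cat; apply/orP/idP.
  by case=> /mapP[k]; rewrite mem_iota => hk ->; lia.
case: i => k hk; [left|right]; apply/mapP; exists k => //; rewrite mem_iota; lia.
Qed.

Lemma mem_ball n u : (u \in ball n) = (norm1 u <= n)%N.
Proof.
rewrite mem_undup mem_filter; case: u => i j.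
have -> : ((i, j) \in box n) = (`|i| <= n)%N && (`|j| <= n)%N.
  rewrite -!mem_ints; apply/allpairsP/andP => [[[a b] /= [? ? [-> ->]]]//|[? ?]].
  by exists (i, j).
by rewrite /norm1 /=; lia.
Qed.

Lemma ball_uniq n : uniq (ball n).
Proof. exact: undup_uniq. Qed.

Lemma size_ball n : (size (ball n) <= (2 * n + 1) ^ 2)%N.
Proof.
rewrite (leq_trans (size_undup _))// size_filter (leq_trans (count_size _ _))//.
by rewrite size_allpairs /ints size_cat !size_map !size_iota; lia.
Qed.

(** All sign choices are listed, so points on the axes are repeated: the list covers the sphere of
    radius [k], and its size is an upper bound for that of the sphere. *)
Definition shell (k : nat) : seq Z2 :=
  flatten [seq [:: (Posz i, Posz (k - i)); (Posz i, - Posz (k - i));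
                   (- Posz i, Posz (k - i)); (- Posz i, - Posz (k - i))] | i <- iota 0 k.+1].

Lemma size_shell k : size (shell k) = (4 * k.+1)%N.
Proof.
rewrite size_flatten /shape -map_comp sumnE big_map.
rewrite (eq_bigr (fun=> 4%N)) // big_const_seq count_predT size_iota iter_addn; lia.
Qed.

Lemma mem_shell u : u \in shell (norm1 u).
Proof.
apply/flattenP; case: u => i j.
exists [:: (Posz `|i|, Posz `|j|); (Posz `|i|, - Posz `|j|);
           (- Posz `|i|, Posz `|j|); (- Posz `|i|, - Posz `|j|)].
  apply/mapP; exists `|i|%N; first by rewrite mem_iota /norm1 /=; lia.
  by have -> : (norm1 (i, j) - `|i| = `|j|)%N by rewrite /norm1 /=; lia.
rewrite !inE !xpair_eqE; lia.
Qed.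

(** * Radial sums over the lattice *)

Lemma sum_norm1_le (R : realType) (S : seq Z2) (n : nat) (f : nat -> R) :
  uniq S -> (forall u, u \in S -> (norm1 u <= n)%N) -> (forall k, 0 <= f k) ->
  \sum_(u <- S) f (norm1 u) <= \sum_(k < n.+1) (4 * k.+1)%:R * f k.
Proof.
move=> uS hS f0.
(* The vertices are grouped by norm, so that each sphere contributes at most [size (shell k)]
   terms. *)
rewrite (eq_big_seq (fun u => \sum_(k < n.+1) if norm1 u == k :> nat then f k else 0)); last first.
  move=> u /hS hu; rewrite -big_mkcond (big_pred1 (Ordinal (hu : (norm1 u < n.+1)%N)))//.
rewrite exchange_big /=; apply: ler_sum => k _.
rewrite -big_mkcond big_const_seq.
rewrite iter_addr_0 -[leLHS]mulr_natl ler_wpM2r// ler_nat -size_shell -size_filter.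
apply: uniq_leq_size; first exact: filter_uniq.
by move=> u; rewrite mem_filter => /andP[/eqP <- _]; exact: mem_shell.
Qed.

(** The sphere of radius [k] contributes [O(k * k ^ (r - alpha))], which is summable for
    [r < alpha - 2]; [alpha > 4] leaves room for some [r > 2]. *)
Lemma A1_moment (R : realType) (J : Z2 -> R) : coupling J -> A1 J ->
  exists r M : R, [/\ 2 < r, r <= 3, 0 < M & forall s : seq Z2, uniq s ->
    \sum_(x <- s) J x * (1 + (norm1 x)%:R) `^ r <= M].
Proof.
move=> [_ [J0 _]] [a [a4 [Jc [Jc0 HJ]]]].
(* The decay exponent is capped at 6 to get [r <= 3]. With [r = b / 2] the summand is
   [O(|x| ^ (- r))], and [r > 2] beats the linear growth of the spheres. *)
pose b := Num.min a 6.
have b4 : 4 < b by rewrite lt_min a4; lra.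
have ba : b <= a by rewrite ge_min lexx.
have b6 : b <= 6 by rewrite ge_min lexx orbT.
pose r := b / 2.
have r2 : 2 < r by rewrite /r; lra.
have r3 : r <= 3 by rewrite /r; lra.
pose c := Jc * 2 `^ r.
have c0 : 0 <= c by rewrite mulr_ge0// powR_ge0.
(* [A1] bounds [J] only away from the origin, so radius 0 is treated apart. *)
pose f (k : nat) : R := if k is 0%N then J origin else c * k%:R `^ (- r).
have f0 k : 0 <= f k by case: k => [|k]; rewrite /f ?mulr_ge0 ?powR_ge0.
have Jf x : J x * (1 + (norm1 x)%:R) `^ r <= f (norm1 x).
  have [->|x0] := eqVneq x origin; first by rewrite /f /= addr0 powR1 mulr1.
  have : (0 < norm1 x)%N.
    rewrite lt0n; apply: contra x0 => /eqP h.
    by rewrite -norm1_zsub_eq0; apply/eqP; move: h; rewrite /norm1 /zsub /origin /=; lia.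
  have := HJ x x0; move: (norm1 x) => [//|k] Hk _.
  have k0 : 0 < k.+1%:R :> R by rewrite ltr0n.
  have h1 : J x <= Jc * k.+1%:R `^ (- b).
    by apply: le_trans Hk _; rewrite ler_wpM2l// ler_powR ?ler1n// lerN2.
  have h2 : (1 + k.+1%:R) `^ r <= 2 `^ r * k.+1%:R `^ r :> R.
    rewrite -powRM//; apply: ge0_ler_powR; rewrite ?nnegrE ?mulr_ge0 ?addr_ge0//; first lra.
    have : 1 <= k.+1%:R :> R by rewrite ler1n.
    lra.
  apply: le_trans (ler_pM _ _ h1 h2) _; rewrite ?powR_ge0//.
  rewrite /f; have -> : - r = - b + r by rewrite /r; field.
  have k1 : k.+1%:R != 0 :> R by rewrite pnatr_eq0.
  by rewrite powRD ?k1 ?implybT//= /c mulrACA.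
(* The terms stand for radius 0, for the positive radii, where [4 * (k + 1) <= 8 * k], and for the
   strict positivity of the bound. *)
exists r, (4 * J origin + 8 * c * (1 + (r - 2)^-1) + 1); split => //.
  have : 0 <= (r - 2)^-1 by rewrite invr_ge0; lra.
  move=> h; rewrite ltr_pwDr// addr_ge0 ?mulr_ge0//; lra.
move=> s us; apply: le_trans (ler_sum _ (fun x _ => Jf x)) _.
pose n := \max_(u <- s) norm1 u.
have hn u : u \in s -> (norm1 u <= n)%N by move=> us'; rewrite /n; exact: leq_bigmax_seq.
apply: le_trans (sum_norm1_le us hn f0) _.
rewrite big_ord_recl /= -addrA; apply: lerD => //.
apply: ler_wpDr => //.
have s0 : 0 < r - 2 by lra.
apply: le_trans (ler_wpM2l _ (powR_sum_le n s0)); last by lra.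
rewrite mulr_sumr; apply: ler_sum => i _.
rewrite /bump /= add1n /f.
have i0 : (i.+1)%:R != 0 :> R by rewrite pnatr_eq0.
have -> : - (1 + (r - 2)) = 1 + - r by lra.
rewrite powRD ?i0 ?implybT// powRr1//.
have : (4 * i.+2)%:R <= 8 * (i.+1)%:R :> R by rewrite -natrM ler_nat; lia.
have : 0 <= c * i.+1%:R `^ (- r) by rewrite mulr_ge0// powR_ge0.
move=> h /(ler_wpM2r h); lra.
Qed.

Lemma ln2_ge (R : realType) : 2^-1 <= ln 2 :> R.
Proof. by have := @ln_succ_ge R 0; rewrite ln1 subr0. Qed.

(** In dimension two the spheres grow linearly, so the inverse square weight gives a harmonic sum.
    This is the source of the logarithm in the theorem. *)
Lemma sum_weight_le (R : realType) (N : nat) (L : R) : (2 <= N)%N -> 1 <= L ->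
  \sum_(u <- ball N) ((Num.max (norm1 u)%:R L) ^+ 2)^-1 <= 32 * ln N%:R.
Proof.
move=> N2 L1.
pose f (k : nat) : R := ((maxn k 1)%:R ^+ 2)^-1.
have f0 k : 0 <= f k by rewrite invr_ge0 exprn_ge0.
have hf u : ((Num.max (norm1 u)%:R L) ^+ 2)^-1 <= f (norm1 u).
  rewrite lef_pV2 ?posrE ?exprn_gt0 ?ltr0n ?leq_max ?orbT//; last first.
    by rewrite lt_max; apply/orP; right; lra.
  apply: lerXn2r; rewrite ?nnegrE ?le_max ?ler0n//.
  by rewrite /maxn; case: ifP => _; rewrite ?L1 ?orbT ?lexx.
apply: le_trans (ler_sum _ (fun u _ => hf u)) _.
have hN u : u \in ball N -> (norm1 u <= N)%N by rewrite mem_ball.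
apply: le_trans (sum_norm1_le (ball_uniq N) hN f0) _.
rewrite big_ord_recl /= /f /= expr1n invr1 mulr1 muln1.
have N0 : (0 < N)%N by lia.
have hs : \sum_(i < N) (4 * (bump 0 i).+1)%:R * ((maxn (bump 0 i) 1)%:R ^+ 2)^-1 <= 8 * (1 + ln N%:R) :> R.
  have := @harmonic_le_ln R N.-1; rewrite prednK// => h.
  apply: le_trans (ler_wpM2l _ h); last by lra.
  rewrite mulr_sumr; apply: ler_sum => i _.
  rewrite /bump /= add1n (maxn_idPl _)//.
  have i0 : 0 < i.+1%:R :> R by rewrite ltr0n.
  rewrite ler_pdivrMr ?exprn_gt0// expr2 mulrA mulfVK ?gt_eqF// -natrM ler_nat; lia.
(* [4 + 8 * (1 + ln N) <= 32 * ln N] because [ln N >= ln 2 >= 1 / 2]. *)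
have l2 : ln 2 <= ln N%:R :> R by rewrite ler_ln ?posrE ?ltr0n// ler_nat.
have := ln2_ge R; lra.
Qed.

(** * Lattice paths: length, weight, edges and enumeration *)

Section Paths.
Context {R : realType}.

(** A path is given as for [path]: its start [u] and the list [g] of its later vertices. *)
Fixpoint plen (u : Z2) (g : seq Z2) : nat :=
  if g is v :: g' then (norm1 (zsub u v) + plen v g')%N else 0%N.

Fixpoint pweight (f : Z2 -> R) (u : Z2) (g : seq Z2) : R :=
  if g is v :: g' then f (zsub u v) * pweight f v g' else 1.

Lemma pweight_ge0 f u g : (forall x, 0 <= f x) -> 0 <= pweight f u g.
Proof. by move=> f0; elim: g u => [|v g IH] u //=; rewrite mulr_ge0. Qed.

Lemma plen_last u g : (norm1 (zsub u (last u g)) <= plen u g)%N.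
Proof.
elim: g u => [|v g IH] u /=; first by rewrite norm1_zsub0.
apply: leq_trans (norm1_triangle u v _) _; rewrite leq_add2l; exact: IH.
Qed.

Lemma plen_mem u g v : v \in u :: g -> (norm1 (zsub u v) <= plen u g)%N.
Proof.
elim: g u => [|z g IH] u /=.
  by rewrite inE => /eqP ->; rewrite norm1_zsub0.
rewrite inE => /orP[/eqP ->|/IH h]; first by rewrite norm1_zsub0.
by apply: leq_trans (norm1_triangle u z _) _; rewrite leq_add2l.
Qed.

Lemma size_le_plen u g : uniq (u :: g) -> (size g <= plen u g)%N.
Proof.
elim: g u => [|z g IH] u //= /andP[ug zg].
have /IH h := zg.
suff k : (0 < norm1 (zsub u z))%N by exact: (leq_add k h).
by rewrite lt0n norm1_zsub_eq0; move: ug; rewrite inE negb_or => /andP[].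
Qed.

(** Submultiplicativity, from [1 + a + b <= (1 + a) * (1 + b)]: a power of the total length is
    absorbed into the weights of the single steps. *)
Lemma plen_powR_le (r : R) u g : 0 <= r ->
  (1 + (plen u g)%:R) `^ r <= pweight (fun x => (1 + (norm1 x)%:R) `^ r) u g.
Proof.
move=> r0; elim: g u => [|z g IH] u /=; first by rewrite addr0 powR1.
apply: le_trans (ler_wpM2l (powR_ge0 _ _) (IH z)).
rewrite -powRM ?addr_ge0//; apply: ge0_ler_powR; rewrite ?nnegrE ?mulr_ge0 ?addr_ge0//.
rewrite natrD; have : 0 <= (norm1 (zsub u z))%:R * (plen z g)%:R :> R by rewrite mulr_ge0.
lra.
Qed.

Lemma pweightM f h u g : pweight f u g * pweight h u g = pweight (fun x => f x * h x) u g.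
Proof. by elim: g u => [|z g IH] u /=; rewrite ?mulr1// mulrACA IH. Qed.

(** Splitting off the first step bounds the total weight of paths of at most [n + 1] steps by 1, for
    the empty path, plus half the bound for [n] steps; 2 is the fixed point. *)
Lemma sum_pweight_le (f : Z2 -> R) : (forall x, 0 <= f x) ->
  (forall s, uniq s -> \sum_(x <- s) f x <= 2^-1) ->
  forall u (S : seq (seq Z2)), uniq S -> \sum_(g <- S) pweight f u g <= 2.
Proof.
move=> f0 fs u S uS.
have [n hn] : exists n, forall g, g \in S -> (size g <= n)%N.
  by exists (\max_(g <- S) size g)%N => g gS; exact: leq_bigmax_seq.
elim: n u S uS hn => [|n IH] u S uS hn.
  apply: (@le_trans _ _ (\sum_(g <- [:: [::]]) pweight f u g)); last by rewrite big_seq1 /=; lra.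
  apply: ler_sum_subset => // [g /hn|g]; last exact: pweight_ge0.
  by rewrite leqn0 size_eq0 inE.
(* [S] is enlarged to the empty path and all combinations of a first vertex from [H] with a
   remainder from [Tl], so that the sum factors. *)
pose H := undup [seq head u g | g <- S].
pose Tl := undup [seq behead g | g <- S].
apply: (@le_trans _ _ (\sum_(g <- [::] :: [seq v :: t | v <- H, t <- Tl]) pweight f u g)).
  apply: ler_sum_subset => // [g gS|g]; last exact: pweight_ge0.
  case: g gS => [|v t] gS; rewrite inE //=; apply/allpairsP; exists (v, t) => /=.
  by split => //; rewrite mem_undup; apply/mapP; exists (v :: t).
rewrite big_cons /= big_allpairs_dep /=.
suff : \sum_(v <- H) \sum_(t <- Tl) f (zsub u v) * pweight f v t <= 1 by lra.
have -> : 1 = 2^-1 * 2 :> R by lra.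
apply: (@le_trans _ _ (\sum_(v <- H) f (zsub u v) * 2)).
  apply: ler_sum => v _; rewrite -mulr_sumr ler_wpM2l//; apply: IH; first exact: undup_uniq.
  by move=> t; rewrite mem_undup => /mapP[g /hn gS ->]; rewrite size_behead -subn1 leq_subLR add1n.
rewrite -mulr_suml ler_wpM2r//.
rewrite -(big_map (zsub u) xpredT f); apply: fs.
by rewrite map_inj_uniq ?undup_uniq//; exact: zsub_injl.
Qed.

(** The representative of an unordered pair for which [RRN] states the product rule. *)
Definition orient (u v : Z2) : Z2 * Z2 := if lt_lex u v then (u, v) else (v, u).

Fixpoint pedges (u : Z2) (g : seq Z2) : seq (Z2 * Z2) :=
  if g is v :: g' then orient u v :: pedges v g' else [::].

Lemma lt_lex_orient u v : u != v -> lt_lex (orient u v).1 (orient u v).2.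
Proof.
rewrite /orient; case: ifPn => //=; case: u v => [a b] [c e].
rewrite /lt_lex xpair_eqE /=; lia.
Qed.

Lemma mem_pedges u g e : e \in pedges u g -> (e.1 \in u :: g) /\ (e.2 \in u :: g).
Proof.
elim: g u => [//|v g IH] u /=; rewrite inE => /orP[/eqP ->|/IH [h1 h2]].
  by rewrite /orient; case: ifP => _ /=; rewrite !inE !eqxx ?orbT.
by split; rewrite inE ?h1 ?h2 orbT.
Qed.

(** The start of a self-avoiding path lies on no later edge, so its first edge does not recur. *)
Lemma pedges_uniq u g : uniq (u :: g) -> uniq (pedges u g).
Proof.
elim: g u => [//|v g IH] u /= /andP[ug vg]; rewrite IH// andbT.
apply/negP => /mem_pedges; rewrite /orient; case: ifP => _ /= [h1 h2].
  by rewrite h1 in ug.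
by rewrite h2 in ug.
Qed.

Lemma pedges_lt_lex u g : uniq (u :: g) -> all (fun e => lt_lex e.1 e.2) (pedges u g).
Proof.
elim: g u => [//|v g IH] u /= /andP[ug vg]; rewrite IH// andbT lt_lex_orient//.
by move: ug; rewrite inE negb_or => /andP[].
Qed.

Lemma path_pedges (sh : Z2 -> Z2 -> bool) u g : (forall a b, sh a b = sh b a) ->
  path sh u g = all (fun e => sh e.1 e.2) (pedges u g).
Proof.
move=> shC; elim: g u => [//|v g IH] u /=; rewrite IH; congr andb.
by rewrite /orient; case: ifP.
Qed.

Lemma pedges_weight (f : Z2 -> R) u g : (forall x, f x = f (zopp x)) ->
  \prod_(e <- pedges u g) f (zsub e.1 e.2) = pweight f u g.
Proof.
move=> fC; elim: g u => [|v g IH] u /=; first by rewrite big_nil.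
rewrite big_cons IH; congr (_ * _); rewrite /orient; case: ifP => _ //=.
by rewrite zsubN -fC.
Qed.

Fixpoint allseqs (V : seq Z2) (k : nat) : seq (seq Z2) :=
  if k is k'.+1 then [::] :: [seq v :: t | v <- V, t <- allseqs V k'] else [:: [::]].

Lemma mem_allseqs V k g : (size g <= k)%N -> {subset g <= V} -> g \in allseqs V k.
Proof.
elim: k g => [|k IH] [|v g] //= sg gV; rewrite inE //=.
apply/allpairsP; exists (v, g); split => //=; first by apply: gV; rewrite mem_head.
by apply: IH => // z zg; apply: gV; rewrite inE zg orbT.
Qed.

(** Each step of a self-avoiding path has length at least 1, so length at most [n] means at most [n]
    steps, all inside the ball of radius [norm1 u + n]: the enumeration misses none. *)
Definition short_paths (u : Z2) (n : nat) : seq (seq Z2) :=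
  undup [seq g <- allseqs (ball (norm1 u + n)) n | uniq (u :: g) && (plen u g <= n)%N].

Lemma mem_short_paths u n g :
  (g \in short_paths u n) = uniq (u :: g) && (plen u g <= n)%N.
Proof.
rewrite mem_undup mem_filter; apply: andb_idr => /andP[ug pg]; apply: mem_allseqs.
  by apply: leq_trans (size_le_plen ug) pg.
move=> v vg; rewrite mem_ball.
have : (norm1 (zsub u v) <= plen u g)%N by apply: plen_mem; rewrite inE vg orbT.
have := norm1_le_zsub v u; rewrite norm1_zsubC; lia.
Qed.

End Paths.

(** * Expectations of bounded variables and probability inequalities *)

Section Expectation.
Context {d : measure_display} {T : measurableType d} {R : realType}.
Variable P : probability T R.
Implicit Types f g h : T -> R.

Definition bounded_rv f : Prop :=
  measurable_fun setT f /\ exists K, forall w, `|f w| <= K.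

Definition Ex f : R := \int[P]_w f w.

Lemma bounded_rv_integrable f : bounded_rv f -> P.-integrable setT (EFin \o f).
Proof.
case=> mf [K hK]; apply: measurable_bounded_integrable => //.
  by rewrite (le_lt_trans (probability_le1 _ _))// ltry.
exists K; split; first by rewrite num_real.
by move=> x Kx w _ /=; exact: le_trans (hK w) (ltW Kx).
Qed.

Lemma bounded_rv_cst c : bounded_rv (fun=> c).
Proof. by split; [exact: measurable_cst|exists `|c|]. Qed.

Lemma bounded_rvD f g : bounded_rv f -> bounded_rv g -> bounded_rv (fun w => f w + g w).
Proof.
case=> mf [K hK] [mg [L hL]]; split; first exact: measurable_funD.
by exists (K + L) => w; apply: le_trans (ler_normD _ _) (lerD (hK w) (hL w)).
Qed.

Lemma bounded_rvM f g : bounded_rv f -> bounded_rv g -> bounded_rv (fun w => f w * g w).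
Proof.
case=> mf [K hK] [mg [L hL]]; split; first exact: measurable_funM.
by exists (K * L) => w; rewrite normrM; apply: ler_pM.
Qed.

Lemma bounded_rvB f g : bounded_rv f -> bounded_rv g -> bounded_rv (fun w => f w - g w).
Proof.
move=> bf bg; have -> : (fun w => f w - g w) = (fun w => f w + (-1) * g w).
  by apply/funext => w; rewrite mulN1r.
by apply: bounded_rvD => //; apply: bounded_rvM => //; exact: bounded_rv_cst.
Qed.

Lemma bounded_rv_sum (I : Type) (s : seq I) (F : I -> T -> R) :
  (forall i, bounded_rv (F i)) -> bounded_rv (fun w => \sum_(i <- s) F i w).
Proof.
move=> bF; elim: s => [|i s IH].
  by under eq_fun do rewrite big_nil; exact: bounded_rv_cst.
by under eq_fun do rewrite big_cons; exact: bounded_rvD.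
Qed.

Lemma bounded_rv_ind (b : T -> bool) : measurable [set w | b w] ->
  bounded_rv (fun w => (b w)%:R).
Proof.
move=> mb; split; last by exists 1 => w; case: (b w); rewrite ?normr1 ?normr0.
have -> : (fun w => (b w)%:R) = \1_[set w | b w] :> (T -> R); last exact: measurable_indic.
by apply/funext => w; rewrite indicE mem_setE.
Qed.

Lemma ExD f g : bounded_rv f -> bounded_rv g ->
  Ex (fun w => f w + g w) = Ex f + Ex g.
Proof. by move=> bf bg; rewrite /Ex RintegralD//; exact: bounded_rv_integrable. Qed.

Lemma ExZ c f : bounded_rv f -> Ex (fun w => c * f w) = c * Ex f.
Proof. by move=> bf; rewrite /Ex RintegralZl//; exact: bounded_rv_integrable. Qed.

Lemma Ex_cst c : Ex (fun=> c) = c.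
Proof. by rewrite /Ex Rintegral_cst// (_ : fine _ = 1) ?mulr1// -[RHS]/(fine 1%E) -(probability_setT P). Qed.

Lemma Ex_le f g : bounded_rv f -> bounded_rv g -> (forall w, f w <= g w) ->
  Ex f <= Ex g.
Proof. by move=> bf bg fg; apply: le_Rintegral => //; exact: bounded_rv_integrable. Qed.

Lemma Ex_ge0 f : (forall w, 0 <= f w) -> 0 <= Ex f.
Proof. by move=> f0; exact: Rintegral_ge0. Qed.

Lemma Ex_sum (I : Type) (s : seq I) (F : I -> T -> R) :
  (forall i, bounded_rv (F i)) ->
  Ex (fun w => \sum_(i <- s) F i w) = \sum_(i <- s) Ex (F i).
Proof.
move=> bF; elim: s => [|i s IH].
  by under eq_fun do rewrite big_nil; rewrite Ex_cst big_nil.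
under eq_fun do rewrite big_cons.
by rewrite ExD// ?IH ?big_cons//; exact: bounded_rv_sum.
Qed.

Lemma Ex_ind (b : T -> bool) : measurable [set w | b w] ->
  (Ex (fun w => (b w)%:R))%:E = P [set w | b w].
Proof.
move=> mb; rewrite /Ex /Rintegral.
have -> : (fun w => ((b w)%:R)%:E) = (fun w => (\1_[set w | b w] w)%:E) :> (T -> \bar R).
  by apply/funext => w; rewrite indicE mem_setE.
by rewrite integral_indic// setIT fineK// fin_num_measure.
Qed.

Lemma bounded_rv_lt f (t : R) : bounded_rv f -> measurable [set w | (t <= f w)%R].
Proof.
case=> mf _; have -> : [set w | (t <= f w)%R] = f @^-1` `[t, +oo[.
  by apply/seteqP; split => w /=; rewrite in_itv /= andbT.
by rewrite -[X in measurable X]setTI; apply: mf.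
Qed.

Lemma markov_ineq f (t m : R) : bounded_rv f -> (forall w, 0 <= f w) -> 0 < t ->
  Ex f <= m -> (P [set w | (t <= f w)%R] <= (m / t)%:E)%E.
Proof.
move=> bf f0 t0 fm; have mt := bounded_rv_lt t bf.
rewrite -Ex_ind// lee_fin ler_pdivlMr//; apply: le_trans fm.
rewrite mulrC -ExZ; last exact: bounded_rv_ind.
apply: Ex_le => //; first by apply: bounded_rvM; [exact: bounded_rv_cst|exact: bounded_rv_ind].
by move=> w; case: (boolP (t <= f w)) => [|_]; [rewrite mulr1|rewrite mulr0].
Qed.

(** Only the pairs related by [near] contribute to the variance, each at most [K ^+ 2] times its
    coefficients. The deviation is counted from an upper bound of the mean. *)
Lemma chebyshev_near (I : Type) (s : seq I) (near : rel I) (c : I -> R)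
    (Y : I -> T -> R) (K m t : R) :
  (forall i, bounded_rv (Y i)) -> (forall i w, 0 <= Y i w <= K) ->
  (forall i, 0 <= c i) -> (forall i, Ex (Y i) <= m) ->
  (forall i j, ~~ near i j -> Ex (fun w => Y i w * Y j w) = Ex (Y i) * Ex (Y j)) ->
  0 < t ->
  (P [set w | (m * \sum_(i <- s) c i + t <= \sum_(i <- s) c i * Y i w)%R] <=
   (K ^+ 2 * (\sum_(i <- s) \sum_(j <- s | near i j) c i * c j) / t ^+ 2)%:E)%E.
Proof.
move=> bY YK c0 Ym indep t0.
pose S w := \sum_(i <- s) c i * Y i w.
have bcY i : bounded_rv (fun w => c i * Y i w) by apply: bounded_rvM => //; exact: bounded_rv_cst.
have bS : bounded_rv S by exact: bounded_rv_sum.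
have ES : Ex S = \sum_(i <- s) c i * Ex (Y i).
  by rewrite Ex_sum//; apply: eq_bigr => i _; rewrite ExZ.
have Em : Ex S <= m * \sum_(i <- s) c i.
  by rewrite ES mulr_sumr; apply: ler_sum => i _; rewrite mulrC ler_wpM2r.
have bYY i j : bounded_rv (fun w => Y i w * Y j w) by exact: bounded_rvM.
have ES2 : Ex (fun w => S w * S w) <= Ex S ^+ 2 + K ^+ 2 * (\sum_(i <- s) \sum_(j <- s | near i j) c i * c j).
  have -> : (fun w => S w * S w) = (fun w => \sum_(i <- s) \sum_(j <- s) (c i * c j) * (Y i w * Y j w)).
    apply/funext => w; rewrite /S mulr_suml; apply: eq_bigr => i _.
    by rewrite mulr_sumr; apply: eq_bigr => j _; rewrite mulrACA.
  have bcc i j : bounded_rv (fun w => (c i * c j) * (Y i w * Y j w)).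
    by apply: bounded_rvM => //; exact: bounded_rv_cst.
  rewrite Ex_sum; last by move=> i; exact: bounded_rv_sum.
  rewrite ES expr2 mulr_suml mulr_sumr -big_split /=; apply: ler_sum => i _.
  rewrite Ex_sum// !mulr_sumr big_mkcond [X in _ + X]big_mkcond -big_split /=.
  rewrite [X in X <= _]big_mkcond /=; apply: ler_sum => j _.
  rewrite ExZ//; case: ifPn => [_|/indep ->]; last by rewrite addr0 mulrACA.
  have YY : Ex (fun w => Y i w * Y j w) <= K ^+ 2.
    rewrite -[leRHS]Ex_cst; apply: Ex_le => //; first exact: bounded_rv_cst.
    by move=> w; have /andP[? ?] := YK i w; have /andP[? ?] := YK j w; rewrite expr2 ler_pM.
  have E0 k : 0 <= Ex (Y k) by apply: Ex_ge0 => w; have /andP[] := YK k w.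
  rewrite [X in _ <= _ + X]mulrC.
  by rewrite -[leLHS]add0r lerD ?mulr_ge0// ler_wpM2l ?mulr_ge0.
have bD : bounded_rv (fun w => (S w - Ex S) * (S w - Ex S)).
  by apply: bounded_rvM; apply: bounded_rvB => //; exact: bounded_rv_cst.
have ED : Ex (fun w => (S w - Ex S) * (S w - Ex S)) <= K ^+ 2 * (\sum_(i <- s) \sum_(j <- s | near i j) c i * c j).
  have -> : (fun w => (S w - Ex S) * (S w - Ex S)) = (fun w => S w * S w + ((- (2 * Ex S)) * S w + Ex S ^+ 2)).
    by apply/funext => w; ring.
  have b2 : bounded_rv (fun w => (- (2 * Ex S)) * S w) by apply: bounded_rvM => //; exact: bounded_rv_cst.
  rewrite ExD; [|exact: bounded_rvM|by apply: bounded_rvD => //; exact: bounded_rv_cst].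
  rewrite ExD//; last exact: bounded_rv_cst.
  rewrite ExZ// Ex_cst; lra.
(* Markov's inequality for the squared deviation from the true mean. *)
have := markov_ineq (t := t ^+ 2) bD (fun w => _) _ ED; rewrite exprn_gt0// => /(_ _ isT) M.
apply: le_trans (M _); last by move=> w; rewrite -expr2 sqr_ge0.
apply: le_measure; rewrite ?inE; [exact: (bounded_rv_lt _ bS)|exact: (bounded_rv_lt _ bD)|].
move=> w /= hw; have : t <= S w - Ex S by rewrite /S in Em *; lra.
by move=> h; rewrite expr2 ler_pM// ltW.
Qed.

Lemma union_bound_countable (I : countType) (E : I -> set T) (p : I -> R) (c : R) :
  (forall i, measurable (E i)) -> (forall i, (P (E i) <= (p i)%:E)%E) ->
  (forall s : seq I, uniq s -> \sum_(i <- s) p i <= c) ->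
  measurable (\bigcup_i E i) /\ (P (\bigcup_i E i) <= c%:E)%E.
Proof.
move=> mE Ep sc.
(* The events are numbered by the codes of their indices; a number that codes nothing gets the empty
   event. *)
pose F k := if @pickle_inv I k is Some i then E i else set0.
have mF k : measurable (F k) by rewrite /F; case: pickle_inv.
have EF : \bigcup_i E i = \bigcup_k F k.
  apply/seteqP; split => [w [i _ Ei]|w [k _]].
    by exists (pickle i) => //; rewrite /F pickleK_inv.
  by rewrite /F; case: pickle_inv => // i Ei; exists i.
have p0 i : 0 <= p i by rewrite -lee_fin; exact: le_trans (Ep i).
rewrite EF; split; first exact: bigcup_measurable.
have /le_trans := @measure_sigma_subadditive _ _ _ P _ _ mF (bigcup_measurable (fun k _ => mF k)) (@subset_refl _ _).
apply; apply: lime_le; first exact: is_cvg_nneseries.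
near=> n.
pose s := pmap (@pickle_inv I) (iota 0 n).
have us : uniq s by exact: (pmap_uniq (@pickle_invK I)) (iota_uniq _ _).
apply: (@le_trans _ _ (\sum_(i <- s) p i)%:E); last by rewrite lee_fin sc.
rewrite /s /index_iota subn0.
elim: (iota 0 n) => [|k l IH]; first by rewrite !big_nil.
rewrite big_cons /= {1}/F; case: pickle_inv => [i|] /=.
  by rewrite big_cons EFinD leeD.
by rewrite measure0 add0e.
Unshelve. all: by end_near. Qed.

End Expectation.

(** * Independence of functionals of disjoint sets of edges *)

Section Independence.
Context {R : realType} {J : Z2 -> R} {eps : R}.
Context {d : measure_display} {T : measurableType d} {P : probability T R}.
Context {xi : Z2 -> Z2 -> T -> bool} (hxi : RRN J eps P xi).
Implicit Types (E F s t : seq (Z2 * Z2)) (X : (Z2 * Z2 -> bool) -> R).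

Definition config (w : T) (e : Z2 * Z2) : bool := xi e.1 e.2 w.

Definition oriented E : bool := all (fun e => lt_lex e.1 e.2) E.

Definition supported_on E X : Prop := forall c c', {in E, c =1 c'} -> X c = X c'.

Definition open_ind s (w : T) : R := (all (config w) s)%:R.

Lemma measurable_all_open s : measurable [set w | all (config w) s].
Proof.
case: hxi => _ [mxi _].
elim: s => [|e s IH] /=; first by rewrite (_ : [set _ | _] = setT)//; apply/seteqP.
rewrite (_ : [set _ | _] = [set w | xi e.1 e.2 w] `&` [set w | all (config w) s]).
  exact: measurableI.
by apply/seteqP; split => w /=; [move/andP|move=> ?; apply/andP].
Qed.

Lemma bounded_open_ind s : bounded_rv (open_ind s).
Proof. exact: bounded_rv_ind (measurable_all_open s). Qed.

Lemma open_ind_cons e s w : open_ind (e :: s) w = (config w e)%:R * open_ind s w.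
Proof. by rewrite /open_ind /= -mulnb natrM. Qed.

Lemma Ex_open_ind s : uniq s -> oriented s ->
  Ex P (open_ind s) = \prod_(e <- s) (eps * J (zsub e.1 e.2)).
Proof.
move=> us os; apply: EFin_inj; rewrite Ex_ind; last exact: measurable_all_open.
by case: hxi => _ [_ <-].
Qed.

(* [RRN] gives the product rule for all-open events only; expanding a functional one
   edge at a time in this form reduces independence to that rule. *)
Lemma supported_on_split e E X : supported_on (e :: E) X ->
  exists X0 X1, [/\ supported_on E X0, supported_on E X1 &
    forall c, X c = X0 c + (c e)%:R * X1 c].
Proof.
move=> sX; pose upd (c : Z2 * Z2 -> bool) b := fun e' => if e' == e then b else c e'.
have sU b : supported_on E (fun c => X (upd c b)).
  move=> c c' cc'; apply: sX => e'; rewrite inE /upd; case: eqP => //= _; exact: cc'.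
exists (fun c => X (upd c false)), (fun c => X (upd c true) - X (upd c false)).
split; [exact: sU|by move=> c c' cc'; rewrite (sU _ _ _ cc') (sU _ _ _ cc')|].
move=> c; have -> : X c = X (upd c (c e)).
  by apply: sX => e' _; rewrite /upd; case: eqP => [->|].
by case: (c e); rewrite ?mul1r ?mul0r ?addr0// addrC subrK.
Qed.

Lemma bounded_supported E X : supported_on E X -> bounded_rv (fun w => X (config w)).
Proof.
elim: E X => [|e E IH] X sX.
  have -> : (fun w => X (config w)) = (fun=> X xpredT); last exact: bounded_rv_cst.
  by apply/funext => w; exact: sX.
have [X0 [X1 [s0 s1 XE]]] := supported_on_split sX.
under eq_fun do rewrite XE.
apply: bounded_rvD; first exact: IH.
apply: bounded_rvM; last exact: IH.
by apply: bounded_rv_ind; case: hxi => _ [mxi _]; exact: mxi.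
Qed.

(** Induction on [E]: splitting [X] at an edge yields one term without it and one where it must be
    open. The latter edges accumulate in [t], and once [E] is exhausted only all-open events
    remain. *)
Lemma Ex_supported_open E X s t : supported_on E X ->
  uniq (s ++ t ++ E) -> oriented (s ++ t ++ E) ->
  Ex P (fun w => X (config w) * (open_ind t w * open_ind s w)) =
  Ex P (fun w => X (config w) * open_ind t w) * \prod_(e <- s) (eps * J (zsub e.1 e.2)).
Proof.
elim: E X t => [|e E IH] X t sX.
  rewrite cats0 => us os.
  have -> : (fun w => X (config w) * (open_ind t w * open_ind s w)) =
            (fun w => X xpredT * open_ind (s ++ t) w).
    by apply/funext => w; rewrite (sX (config w) xpredT)// /open_ind all_cat -mulnb natrM [_%:R * _]mulrC.
  have -> : (fun w => X (config w) * open_ind t w) = (fun w => X xpredT * open_ind t w).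
    by apply/funext => w; rewrite (sX (config w) xpredT).
  move: (us) (os); rewrite cat_uniq /oriented all_cat => /and3P[_ _ ut] /andP[_ ot].
  rewrite !ExZ; [|exact: bounded_open_ind..].
  by rewrite !Ex_open_ind// big_cat /= -mulrA; congr (_ * _); rewrite mulrC.
move=> us os; have [X0 [X1 [s0 s1 XE]]] := supported_on_split sX.
have us' : uniq (s ++ (e :: t) ++ E).
  by rewrite (perm_uniq (s2 := s ++ t ++ e :: E))// perm_cat2l perm_sym -cat_rcons perm_cat2r perm_rcons.
have os' : oriented (s ++ (e :: t) ++ E).
  by rewrite /oriented (perm_all (s2 := s ++ t ++ e :: E))// perm_cat2l perm_sym -cat_rcons perm_cat2r perm_rcons.
have us0 : uniq (s ++ t ++ E).
  apply: subseq_uniq us'; apply: cat_subseq => //; exact: subseq_cons.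
have os0 : oriented (s ++ t ++ E).
  apply/allP => e' e'E; apply: (allP os'); apply: mem_subseq e'E.
  by apply: cat_subseq => //; exact: subseq_cons.
have b0 := bounded_supported s0; have b1 := bounded_supported s1.
have -> : (fun w => X (config w) * (open_ind t w * open_ind s w)) =
   (fun w => X0 (config w) * (open_ind t w * open_ind s w) +
             X1 (config w) * (open_ind (e :: t) w * open_ind s w)).
  by apply/funext => w; rewrite XE open_ind_cons; ring.
have -> : (fun w => X (config w) * open_ind t w) =
   (fun w => X0 (config w) * open_ind t w + X1 (config w) * open_ind (e :: t) w).
  by apply/funext => w; rewrite XE open_ind_cons; ring.
have bo := bounded_open_ind.
rewrite !ExD; [|do ?exact: bounded_rvM..]; rewrite ?mulrDl; try by do ?apply: bounded_rvM.
by rewrite IH// [X in _ + X = _]IH.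
Qed.

(** The same induction on [F], whose open edges accumulate in [s]; the base case is
    [Ex_supported_open]. *)
Lemma Ex_indep_open E F X Y s : supported_on E X -> supported_on F Y ->
  uniq (s ++ E ++ F) -> oriented (s ++ E ++ F) ->
  Ex P (fun w => X (config w) * (Y (config w) * open_ind s w)) =
  Ex P (fun w => X (config w)) * Ex P (fun w => Y (config w) * open_ind s w).
Proof.
move=> sX; have bX := bounded_supported sX.
elim: F Y s => [|e F IH] Y s sY.
  rewrite cats0 => us os.
  have YE w : Y (config w) = Y xpredT by exact: sY.
  have -> : (fun w => X (config w) * (Y (config w) * open_ind s w)) =
            (fun w => Y xpredT * (X (config w) * open_ind s w)).
    by apply/funext => w; rewrite YE mulrCA.
  have -> : (fun w => Y (config w) * open_ind s w) = (fun w => Y xpredT * open_ind s w).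
    by apply/funext => w; rewrite YE.
  rewrite !ExZ; [|by do ?[apply: bounded_rvM|exact: bounded_open_ind]..].
  have := Ex_supported_open (s := s) (t := [::]) sX; rewrite /= => /(_ us os).
  have -> : (fun w => X (config w) * (open_ind [::] w * open_ind s w)) = (fun w => X (config w) * open_ind s w).
    by apply/funext => w; rewrite [open_ind [::] w]/open_ind /= mul1r.
  have -> : (fun w => X (config w) * open_ind [::] w) = (fun w => X (config w)).
    by apply/funext => w; rewrite [open_ind [::] w]/open_ind /= mulr1.
  move=> ->; rewrite mulrCA; congr (_ * (_ * _)); rewrite Ex_open_ind//.
    by move: us; rewrite cat_uniq => /and3P[].
  by move: os; rewrite /oriented all_cat => /andP[].
move=> us os; have [Y0 [Y1 [s0 s1 YE]]] := supported_on_split sY.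
have pe : perm_eq ((e :: s) ++ E ++ F) (s ++ E ++ e :: F).
  by apply/permP => p; rewrite /= !count_cat /= addnCA; congr addn; rewrite addnCA.
have us' : uniq ((e :: s) ++ E ++ F) by rewrite (perm_uniq pe).
have os' : oriented ((e :: s) ++ E ++ F) by rewrite /oriented (perm_all _ pe).
have us0 : uniq (s ++ E ++ F) by move: us' => /= /andP[].
have os0 : oriented (s ++ E ++ F) by move: os' => /= /andP[].
have b0 := bounded_supported s0; have b1 := bounded_supported s1.
have bo := bounded_open_ind.
have -> : (fun w => X (config w) * (Y (config w) * open_ind s w)) =
   (fun w => X (config w) * (Y0 (config w) * open_ind s w) +
             X (config w) * (Y1 (config w) * open_ind (e :: s) w)).
  by apply/funext => w; rewrite YE open_ind_cons; ring.
have -> : (fun w => Y (config w) * open_ind s w) =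
   (fun w => Y0 (config w) * open_ind s w + Y1 (config w) * open_ind (e :: s) w).
  by apply/funext => w; rewrite YE open_ind_cons; ring.
rewrite !ExD; try by do ?apply: bounded_rvM.
by rewrite mulrDr IH// [X in _ + X = _]IH.
Qed.

Lemma Ex_indep E F X Y : supported_on E X -> supported_on F Y ->
  oriented E -> oriented F -> (forall e, e \in E -> e \notin F) ->
  Ex P (fun w => X (config w) * Y (config w)) =
  Ex P (fun w => X (config w)) * Ex P (fun w => Y (config w)).
Proof.
move=> sX sY oE oF EF.
have sX' : supported_on (undup E) X.
  by move=> c c' h; apply: sX => e eE; apply: h; rewrite mem_undup.
have sY' : supported_on (undup F) Y.
  by move=> c c' h; apply: sY => e eE; apply: h; rewrite mem_undup.
have := Ex_indep_open (s := [::]) sX' sY'; rewrite /= => /(_ _ _)/=.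
have -> : (fun w => X (config w) * (Y (config w) * open_ind [::] w)) = (fun w => X (config w) * Y (config w)).
  by apply/funext => w; rewrite [open_ind [::] w]/open_ind /= mulr1.
have -> : (fun w => Y (config w) * open_ind [::] w) = (fun w => Y (config w)).
  by apply/funext => w; rewrite [open_ind [::] w]/open_ind /= mulr1.
apply; rewrite ?cat_uniq ?undup_uniq//=.
  rewrite andbT; apply/hasPn => e; rewrite !mem_undup => eF; apply/negP => /EF; by rewrite eF.
by rewrite /oriented all_cat !all_undup; apply/andP.
Qed.

End Independence.

(** * Moments and tails of shorted paths *)

Section PathEvents.
Context {R : realType} {J : Z2 -> R} {eps : R}.
Context {d : measure_display} {T : measurableType d} {P : probability T R}.
Context {xi : Z2 -> Z2 -> T -> bool} (hxi : RRN J eps P xi).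
Context (J_sym : forall x, J x = J (zopp x)) (J_ge0 : forall x, 0 <= J x).
Context (eps_ge0 : 0 <= eps).
Context (r : R) (r_gt2 : 2 < r).
Context (moment_le : forall s, uniq s ->
  \sum_(x <- s) eps * J x * (1 + (norm1 x)%:R) `^ r <= 2^-1).

Definition path_prob (u : Z2) (g : seq Z2) : R := pweight (fun x => eps * J x) u g.

Lemma path_prob_ge0 u g : 0 <= path_prob u g.
Proof. by apply: pweight_ge0 => x; rewrite mulr_ge0. Qed.

Lemma Ex_path u g : uniq (u :: g) ->
  Ex P (open_ind (xi := xi) (pedges u g)) = path_prob u g.
Proof.
move=> ug; rewrite (Ex_open_ind hxi (pedges_uniq ug) (pedges_lt_lex ug)).
by rewrite (pedges_weight (f := fun x => eps * J x))// => x; rewrite -J_sym.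
Qed.

(** The basic subcriticality estimate: by [plen_powR_le] each summand is at most a product over the
    steps, and one step has total weight at most 1/2. The bounds on long, middle and short paths all
    rest on it. *)
Lemma sum_path_moment_le u S : uniq S ->
  \sum_(g <- S) path_prob u g * (1 + (plen u g)%:R) `^ r <= 2.
Proof.
move=> uS; have r0 : 0 <= r by have := r_gt2; lra.
pose f x := eps * J x * (1 + (norm1 x)%:R) `^ r.
apply: le_trans (@sum_pweight_le R f _ moment_le u S uS).
  apply: ler_sum => g _; rewrite /f -pweightM ler_wpM2l ?path_prob_ge0//.
  exact: plen_powR_le.
by move=> x; rewrite /f !mulr_ge0 ?powR_ge0.
Qed.

Lemma sum_path_tail_le u S (n : nat) : uniq S ->
  \sum_(g <- S | (n < plen u g)%N) path_prob u g <= 2 * (1 + n%:R) `^ (- r).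
Proof.
move=> uS; rewrite -ler_pdivrMr ?powR_gt0 ?ltr_wpDr// powRN invrK.
apply: le_trans (sum_path_moment_le u uS).
rewrite mulr_suml big_mkcond /=; apply: ler_sum => g _.
case: ifPn => h; last by rewrite mulr_ge0 ?path_prob_ge0 ?powR_ge0.
rewrite ler_wpM2l ?path_prob_ge0//; apply: ge0_ler_powR; rewrite ?nnegrE ?addr_ge0//; first by have := r_gt2; lra.
by rewrite lerD2l ler_nat ltnW.
Qed.

Definition long_path (N m : nat) (i : Z2 * seq Z2) : bool :=
  [&& i.1 \in ball N, uniq (i.1 :: i.2) & (m < plen i.1 i.2)%N].

(** The condition on the path is part of the event, so that the union runs over a whole countable
    type and the other indices contribute the empty event. *)
Definition long_open (N m : nat) : set T :=
  \bigcup_(i : Z2 * seq Z2) [set w | long_path N m i && all (config (xi := xi) w) (pedges i.1 i.2)].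

Lemma long_open_prob N m : measurable (long_open N m) /\
  (P (long_open N m) <= ((size (ball N))%:R * (2 * (1 + m%:R) `^ (- r)))%:E)%E.
Proof.
pose p (i : Z2 * seq Z2) := if long_path N m i then path_prob i.1 i.2 else 0.
apply: (@union_bound_countable _ _ _ P ((int * int) * seq (int * int))%type _ p).
- move=> i; case: (long_path N m i) => /=; first exact: measurable_all_open hxi _.
  by rewrite (_ : [set _ | _] = set0)//; apply/seteqP; split.
- move=> i; rewrite /p; case: ifPn => h /=.
    have /and3P[_ ug _] := h; rewrite -(Ex_path ug) Ex_ind//.
    exact: measurable_all_open hxi _.
  by rewrite (_ : [set _ | _] = set0) ?measure0//; apply/seteqP; split.
move=> s us.
(* A finite family of pairs is enlarged to a product of starts in the ball and remainders in [G], so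
   that [sum_path_tail_le] applies to each start. *)
pose G := undup [seq i.2 | i <- s].
have p0 i : 0 <= p i by rewrite /p; case: ifP => // _; exact: path_prob_ge0.
rewrite (bigID (fun i => i.1 \in ball N)) /= [X in _ + X]big1 ?addr0; last first.
  by move=> i h; rewrite /p /long_path (negbTE h).
rewrite -big_filter.
apply: (@le_trans _ _ (\sum_(i <- [seq (u, g) | u <- ball N, g <- G]) p i)).
  apply: ler_sum_subset => //; first exact: filter_uniq.
  move=> [u g]; rewrite mem_filter /= => /andP[uN h]; apply/allpairsP; exists (u, g); split => //=.
  by rewrite mem_undup; apply/mapP; exists (u, g).
rewrite big_allpairs_dep /=.
have -> a : (size (ball N))%:R * a = \sum_(u <- ball N) a :> R.
  by rewrite big_const_seq count_predT iter_addr_0 mulr_natl.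
apply: ler_sum => u _; apply: le_trans (sum_path_tail_le u m (undup_uniq _)).
rewrite [leRHS]big_mkcond /=; apply: ler_sum => g _.
rewrite /p /long_path /=; case: (m < _)%N; rewrite ?andbF//.
by case: ifP => // _; exact: path_prob_ge0.
Qed.

(** A maximum is at most [n ^+ 2], the uniform bound that Chebyshev's inequality calls for. For
    [mid_sum] only the mean matters, and a sum has its mean computed path by path. *)
Definition short_max (n : nat) (u : Z2) (c : Z2 * Z2 -> bool) : R :=
  \big[Num.max/0]_(g <- short_paths u n | all c (pedges u g)) (plen u g)%:R ^+ 2.

Definition mid_sum (n m : nat) (u : Z2) (c : Z2 * Z2 -> bool) : R :=
  \sum_(g <- short_paths u m | (n < plen u g)%N) (plen u g)%:R ^+ 2 * (all c (pedges u g))%:R.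

Lemma short_max_ge0 n u c : 0 <= short_max n u c.
Proof. exact: bigmax_ge_id. Qed.

Lemma short_max_le n u c : short_max n u c <= n%:R ^+ 2.
Proof.
rewrite /short_max big_seq_cond; apply: bigmax_le; first by rewrite exprn_ge0.
by move=> g /andP[]; rewrite mem_short_paths => /andP[_ h] _; apply: lerXn2r; rewrite ?nnegrE// ler_nat.
Qed.

Lemma short_max_ge n u c g : uniq (u :: g) -> (plen u g <= n)%N ->
  all c (pedges u g) -> (plen u g)%:R ^+ 2 <= short_max n u c.
Proof.
move=> ug pg cg; rewrite /short_max.
have gS : g \in short_paths u n by rewrite mem_short_paths ug pg.
exact: (@le_bigmax_seq _ _ _ _ _ g _ (fun g => (plen u g)%:R ^+ 2) gS cg).
Qed.

Lemma mid_sum_ge0 n m u c : 0 <= mid_sum n m u c.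
Proof. by apply: sumr_ge0 => g _; rewrite mulr_ge0// exprn_ge0. Qed.

Lemma mid_sum_ge n m u c g : uniq (u :: g) -> (n < plen u g <= m)%N ->
  all c (pedges u g) -> (plen u g)%:R ^+ 2 <= mid_sum n m u c.
Proof.
move=> ug /andP[ng gm] cg; rewrite /mid_sum big_mkcond (bigD1_seq g) ?undup_uniq//=; last first.
  by rewrite mem_short_paths ug gm.
by rewrite ng cg mulr1 lerDl; apply: sumr_ge0 => h _; case: ifP => // _; rewrite mulr_ge0// exprn_ge0.
Qed.

Definition path_edges (n : nat) (u : Z2) : seq (Z2 * Z2) :=
  flatten [seq pedges u g | g <- short_paths u n].

Lemma short_max_supported n u : supported_on (path_edges n u) (short_max n u).
Proof.
move=> c c' cc'; rewrite /short_max big_seq_cond [RHS]big_seq_cond; apply: eq_bigl => g.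
case: (boolP (g \in _)) => //= gS; apply: eq_in_all => e eg; apply: cc'.
by apply/flattenP; exists (pedges u g) => //; exact: map_f.
Qed.

Lemma mid_sum_supported n m u : supported_on (path_edges m u) (mid_sum n m u).
Proof.
move=> c c' cc'; rewrite /mid_sum big_seq_cond [RHS]big_seq_cond; apply: eq_bigr => g /andP[gS _].
congr (_ * _%:R); congr nat_of_bool; apply: eq_in_all => e eg; apply: cc'.
by apply/flattenP; exists (pedges u g) => //; exact: map_f.
Qed.

Lemma path_edges_oriented n u : oriented (path_edges n u).
Proof.
apply/allP => e /flattenP[_ /mapP[g gS ->]] eg.
by move: gS; rewrite mem_short_paths => /andP[ug _]; exact: (allP (pedges_lt_lex ug)).
Qed.

(** A path of length at most [n] stays within [n] of its start, so a common edge would put the two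
    starts within [2 * n]. *)
Lemma path_edges_disjoint n u v : (2 * n < norm1 (zsub u v))%N ->
  forall e, e \in path_edges n u -> e \notin path_edges n v.
Proof.
have near z e : e \in path_edges n z -> (norm1 (zsub z e.1) <= n)%N.
  move=> /flattenP[_ /mapP[g gS ->]] /mem_pedges[h _].
  move: gS; rewrite mem_short_paths => /andP[_ pg]; apply: leq_trans pg; exact: plen_mem.
move=> uv e /near h1; apply/negP => /near h2; rewrite norm1_zsubC in h2.
have := norm1_triangle u e.1 v; lia.
Qed.

Lemma bounded_short_max n u : bounded_rv (fun w => short_max n u (config (xi := xi) w)).
Proof. exact: (bounded_supported hxi (@short_max_supported n u)). Qed.

Lemma bounded_mid_sum n m u : bounded_rv (fun w => mid_sum n m u (config (xi := xi) w)).
Proof. exact: (bounded_supported hxi (@mid_sum_supported n m u)). Qed.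

Lemma sqr_le_powR (k : nat) : k%:R ^+ 2 <= (1 + k%:R) `^ r :> R.
Proof.
have h : k%:R ^+ 2 <= (1 + k%:R) `^ 2%:R :> R.
  by rewrite powR_mulrn ?addr_ge0//; apply: lerXn2r; rewrite ?nnegrE ?addr_ge0// lerDr.
by apply: le_trans h _; apply: ler_powR; [rewrite lerDl|exact: ltW].
Qed.

Lemma Ex_path_sum n m u : Ex P (fun w => mid_sum n m u (config (xi := xi) w)) =
  \sum_(g <- short_paths u m | (n < plen u g)%N) (plen u g)%:R ^+ 2 * path_prob u g.
Proof.
rewrite /mid_sum; under eq_fun do rewrite -big_filter.
have bo s : bounded_rv (open_ind (xi := xi) s) := bounded_open_ind hxi s.
rewrite Ex_sum; last by move=> g; apply: bounded_rvM; [exact: bounded_rv_cst|exact: bo].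
rewrite big_filter big_seq_cond [RHS]big_seq_cond; apply: eq_bigr => g /andP[].
by rewrite mem_short_paths => /andP[ug _] _; rewrite ExZ ?(Ex_path ug)//; exact: bo.
Qed.

(** A length [T > n] satisfies [T ^+ 2 <= (1 + T) ^ r * (1 + n) ^ (2 - r)], so the moment of order
    [r > 2] gains a negative power of [n]. *)
Lemma Ex_mid_sum n m u :
  Ex P (fun w => mid_sum n m u (config (xi := xi) w)) <= 2 * (1 + n%:R) `^ (2 - r).
Proof.
rewrite Ex_path_sum; have n1 : 0 < 1 + n%:R :> R by rewrite ltr_wpDr.
have -> : 2 - r = - (r - 2) by lra.
rewrite powRN -ler_pdivrMr ?invr_gt0 ?powR_gt0// invrK.
apply: le_trans (sum_path_moment_le u (undup_uniq _)).
rewrite mulr_suml big_mkcond /=; apply: ler_sum => g _.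
case: ifPn => h; last by rewrite mulr_ge0 ?path_prob_ge0 ?powR_ge0.
rewrite mulrAC mulrC ler_wpM2l ?path_prob_ge0//.
have -> : (1 + (plen u g)%:R) `^ r = (1 + (plen u g)%:R) `^ 2%:R * (1 + (plen u g)%:R) `^ (r - 2) :> R.
  have h1 : 1 + (plen u g)%:R != 0 :> R by rewrite gt_eqF// ltr_wpDr.
  by rewrite -powRD ?h1 ?implybT//; congr powR; ring.
apply: ler_pM; rewrite ?exprn_ge0 ?powR_ge0//.
  by rewrite powR_mulrn ?addr_ge0//; apply: lerXn2r; rewrite ?nnegrE ?addr_ge0// lerDr.
have r2 : 0 <= r - 2 by rewrite subr_ge0 ltW.
by apply: (ge0_ler_powR r2); rewrite ?nnegrE ?addr_ge0// lerD2l ler_nat ltnW.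
Qed.

(** The maximum is at most the sum over all short paths, and squares are below the power [r]. *)
Lemma Ex_short_max n u : Ex P (fun w => short_max n u (config (xi := xi) w)) <= 2.
Proof.
pose S w := \sum_(g <- short_paths u n) (plen u g)%:R ^+ 2 * open_ind (xi := xi) (pedges u g) w : R.
have bo s : bounded_rv (open_ind (xi := xi) s) := bounded_open_ind hxi s.
have bt g : bounded_rv (fun w => (plen u g)%:R ^+ 2 * open_ind (xi := xi) (pedges u g) w : R).
  by apply: bounded_rvM; [exact: bounded_rv_cst|exact: bo].
apply: (@le_trans _ _ (Ex P S)).
  apply: Ex_le; [exact: bounded_short_max|exact: bounded_rv_sum|] => w.
  rewrite /short_max big_seq_cond; apply: bigmax_le.
    by apply: sumr_ge0 => g _; rewrite mulr_ge0 ?exprn_ge0// /open_ind.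
  move=> g /andP[gS og]; rewrite /S (bigD1_seq g) ?undup_uniq//= /open_ind og mulr1 lerDl.
  by apply: sumr_ge0 => h _; rewrite mulr_ge0 ?exprn_ge0.
rewrite Ex_sum//; apply: le_trans (sum_path_moment_le u (undup_uniq _)).
rewrite big_seq [leRHS]big_seq; apply: ler_sum => g; rewrite mem_short_paths => /andP[ug _].
rewrite ExZ; last exact: bo.
by rewrite (Ex_path ug) mulrC ler_wpM2l ?path_prob_ge0 ?sqr_le_powR.
Qed.

(** Chebyshev's inequality, where vertices are near when at distance at most [2 * n]: a translate of
    [ball (2 * n)] contains all those near a given vertex. *)
Lemma short_sum_prob (N n : nat) (c : Z2 -> R) (cm W t : R) :
  (forall u, 0 <= c u <= cm) -> \sum_(u <- ball N) c u <= W -> 0 < t ->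
  (P [set w | (2 * (\sum_(u <- ball N) c u) + t <=
       \sum_(u <- ball N) c u * short_max n u (config (xi := xi) w))%R] <=
   ((n%:R ^+ 2) ^+ 2 * (W * ((size (ball (2 * n)))%:R * cm)) / t ^+ 2)%:E)%E.
Proof.
move=> c0 cW t0.
pose near (u v : Z2) := (norm1 (zsub u v) <= 2 * n)%N.
have := @chebyshev_near _ _ _ P Z2 (ball N) near c (fun u w => short_max n u (config (xi := xi) w)) (n%:R ^+ 2) 2 t.
move=> /(_ (bounded_short_max n) _ _ (Ex_short_max n) _ t0) H.
apply: le_trans (H _ _ _) _.
- by move=> u w; rewrite short_max_ge0 short_max_le.
- by move=> u; have /andP[] := c0 u.
- move=> u v; rewrite -ltnNge => uv.
  apply: (Ex_indep hxi (@short_max_supported n u) (@short_max_supported n v)); rewrite ?path_edges_oriented//.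
  exact: path_edges_disjoint.
rewrite lee_fin ler_pM2r ?invr_gt0 ?exprn_gt0//; apply: ler_wpM2l; first by rewrite !exprn_ge0.
have cm0 : 0 <= cm by have /andP[] := c0 origin; exact: le_trans.
apply: (@le_trans _ _ (\sum_(u <- ball N) c u * ((size (ball (2 * n)))%:R * cm))); last first.
  by rewrite -mulr_suml ler_wpM2r// mulr_ge0.
apply: ler_sum => u _; rewrite -mulr_sumr; have /andP[cu _] := c0 u; apply: ler_wpM2l => //.
apply: (@le_trans _ _ (\sum_(v <- ball N | near u v) cm)).
  by apply: ler_sum => v _; have /andP[] := c0 v.
rewrite -big_filter big_const_seq count_predT iter_addr_0 -[leLHS]mulr_natl ler_wpM2r// ler_nat.
rewrite -(size_map (zsub u)); apply: uniq_leq_size.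
  by rewrite map_inj_uniq ?filter_uniq ?ball_uniq//; exact: zsub_injl.
by move=> z /mapP[v]; rewrite mem_filter => /andP[uv _] ->; rewrite mem_ball.
Qed.

Lemma mid_sum_prob (N n m : nat) (c : Z2 -> R) (W t : R) :
  (forall u, 0 <= c u) -> \sum_(u <- ball N) c u <= W -> 0 < t ->
  (P [set w | (t <= \sum_(u <- ball N) c u * mid_sum n m u (config (xi := xi) w))%R] <=
   (W * (2 * (1 + n%:R) `^ (2 - r)) / t)%:E)%E.
Proof.
move=> c0 cW t0.
have bt u : bounded_rv (fun w => c u * mid_sum n m u (config (xi := xi) w)).
  by apply: bounded_rvM; [exact: bounded_rv_cst|exact: bounded_mid_sum].
apply: markov_ineq => //; first exact: bounded_rv_sum.
  by move=> w; apply: sumr_ge0 => u _; rewrite mulr_ge0 ?mid_sum_ge0.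
rewrite Ex_sum//.
apply: (@le_trans _ _ (\sum_(u <- ball N) c u * (2 * (1 + n%:R) `^ (2 - r)))).
  by apply: ler_sum => u _; rewrite ExZ ?ler_wpM2l ?Ex_mid_sum//; exact: bounded_mid_sum.
by rewrite -mulr_suml ler_wpM2r// mulr_ge0// powR_ge0.
Qed.

End PathEvents.

(** * Loop erasure and clusters of shorted edges *)

Lemma path_uniq_connect (e : rel Z2) u g : path e u g ->
  exists g', [/\ path e u g', uniq (u :: g') & last u g' = last u g].
Proof. by move=> /shortenP[g' ? ? _]; exists g'. Qed.

Definition linked (sh : Z2 -> Z2 -> bool) (u v : Z2) : Prop :=
  exists g, path sh u g /\ last u g = v.

Lemma linked_refl sh u : linked sh u u.
Proof. by exists [::]. Qed.

Lemma linked_trans sh v u t : linked sh u v -> linked sh v t -> linked sh u t.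
Proof.
move=> [g [pg <-]] [h [ph <-]]; exists (g ++ h).
by rewrite cat_path pg ph last_cat.
Qed.

Lemma linked_sym sh u v : (forall a b, sh a b = sh b a) -> linked sh u v -> linked sh v u.
Proof.
move=> shC [g]; elim: g u => [|z g IH] u /=; first by case=> _ <-; exact: linked_refl.
case=> /andP[uz pg] hl; apply: linked_trans (IH z _) _; first by [].
by exists [:: u]; rewrite /= shC uz.
Qed.

(** * The logarithmic profile and its Lipschitz bounds *)

Section LogProfile.
Context {R : realType} (N : nat) (L : R).
Context (L_ge1 : 1 <= L) (L_lt : L < N%:R / 2).

Definition slope : R := (ln (N%:R / 2) - ln L)^-1.

Definition radius (u : Z2) : R := Num.max (norm1 u)%:R L.

Definition profile (u : Z2) : R := Num.max 0 (1 - slope * (ln (radius u) - ln L)).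

Lemma L_gt0 : 0 < L.
Proof. exact: lt_le_trans L_ge1. Qed.

Lemma half_gt0 : 0 < N%:R / 2 :> R.
Proof. exact: lt_trans L_gt0 L_lt. Qed.

Lemma slope_gt0 : 0 < slope.
Proof. by rewrite invr_gt0 subr_gt0 ltr_ln ?posrE ?L_gt0 ?half_gt0. Qed.

Lemma radius_geL u : L <= radius u.
Proof. by rewrite le_max lexx orbT. Qed.

Lemma radius_gt0 u : 0 < radius u.
Proof. exact: lt_le_trans L_gt0 (radius_geL u). Qed.

Lemma profile_ge0 u : 0 <= profile u.
Proof. by rewrite le_max lexx. Qed.

Lemma profile_le1 u : profile u <= 1.
Proof.
rewrite ge_max ler01 /= lerBlDr lerDl mulr_ge0 ?(ltW slope_gt0)// subr_ge0.
by rewrite ler_ln ?posrE ?radius_gt0 ?radius_geL ?L_gt0.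
Qed.

Lemma profile_origin : profile origin = 1.
Proof.
have r0 : radius origin = L by apply: max_idPr; exact: (ltW L_gt0).
rewrite /profile r0.
by rewrite subrr mulr0 subr0 (max_idPr _).
Qed.

Lemma profile_eq0 u : N%:R / 2 <= (norm1 u)%:R :> R -> profile u = 0.
Proof.
move=> h; apply: max_idPl; rewrite subr_le0 -(mulVf (x := ln (N%:R / 2) - ln L)); last first.
  by rewrite gt_eqF// subr_gt0 ltr_ln ?posrE ?L_gt0 ?half_gt0.
rewrite ler_wpM2l ?(ltW slope_gt0)// lerD2r.
have rN : N%:R / 2 <= radius u by rewrite le_max h.
by rewrite ler_ln ?posrE ?radius_gt0 ?half_gt0.
Qed.

Lemma radius_lip u v : `|radius u - radius v| <= (norm1 (zsub u v))%:R.
Proof.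
have h a b : radius a <= (norm1 (zsub a b))%:R + radius b.
  rewrite /radius ge_max; apply/andP; split.
    by apply: (@le_trans _ _ (norm1 (zsub a b) + norm1 b)%:R);
      rewrite ?ler_nat ?norm1_le_zsub// natrD lerD2l le_max lexx.
  by rewrite ler_wpDl// le_max lexx orbT.
rewrite ler_norml; apply/andP; split; last by rewrite lerBlDr h.
by rewrite lerNl opprB lerBlDr norm1_zsubC h.
Qed.

Lemma profile_lip_one u v : 2 * (norm1 (zsub u v))%:R <= L ->
  profile u - profile v <= 2 * slope * (norm1 (zsub u v))%:R / radius u.
Proof.
move=> uvL; have ru := radius_gt0 u; have rv := radius_gt0 v.
have s0 := slope_gt0; have lp := radius_lip u v.
have lu := radius_geL u.
set n1 := (norm1 (zsub u v))%:R in uvL lp *.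
have n0 : 0 <= n1 by rewrite /n1.
have pos : 0 <= 2 * slope * n1 / radius u by rewrite divr_ge0 ?(ltW ru)// mulr_ge0// mulr_ge0// ltW.
(* Truncation at 0 does not enlarge a positive difference, so only the logarithms have to be
   compared. *)
suff h : slope * (ln (radius v) - ln (radius u)) <= 2 * slope * n1 / radius u.
  rewrite {1 2}/profile; case: (leP 0 (1 - slope * (ln (radius u) - ln L))) => h1; case: (leP 0 (1 - slope * (ln (radius v) - ln L))) => h2; lra.
have -> : 2 * slope * n1 / radius u = slope * (2 * n1 / radius u) by ring.
rewrite ler_pM2l//; apply: le_trans (ln_lip rv ru) _.
rewrite ler_pM2r ?invr_gt0//.
by move: lp; rewrite ler_norml => /andP[h _]; lra.
Qed.

Lemma radius_half u v : 2 * (norm1 (zsub u v))%:R <= L -> radius u <= 2 * radius v.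
Proof.
move=> uvL; have lp := radius_lip u v; have lv := radius_geL v; have rv := radius_gt0 v.
by move: lp; rewrite ler_norml => /andP[_ h]; lra.
Qed.

(** The one-sided bound is used in both directions. The one that involves [radius v] is brought back
    to [radius u] by [radius_half], at the cost of a factor 2, whence [16 = (2 * 2) ^+ 2]. *)
Lemma profile_sqr_lip u v : 2 * (norm1 (zsub u v))%:R <= L ->
  (profile u - profile v) ^+ 2 <= 16 * slope ^+ 2 * ((radius u) ^+ 2)^-1 * (norm1 (zsub u v))%:R ^+ 2.
Proof.
move=> uvL; have ru := radius_gt0 u; have rv := radius_gt0 v; have s0 := slope_gt0.
have h1 := profile_lip_one uvL.
have uvL' : 2 * (norm1 (zsub v u))%:R <= L by rewrite norm1_zsubC.
have h2 := profile_lip_one uvL'; rewrite norm1_zsubC in h2.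
have h3 : (radius v)^-1 <= 2 * (radius u)^-1.
  by rewrite -[2]invrK -invfM lef_pV2 ?posrE ?mulr_gt0 ?invr_gt0//; have := radius_half uvL; lra.
set n1 := (norm1 (zsub u v))%:R in h1 h2 *.
have n0 : 0 <= n1 by rewrite /n1.
have -> : 16 * slope ^+ 2 * (radius u ^+ 2)^-1 * n1 ^+ 2 = (4 * slope * n1 / radius u) ^+ 2.
  by rewrite !expr2 invfM; ring.
have sn : 0 <= slope * n1 by rewrite mulr_ge0// ltW.
have h4 := ler_wpM2l sn h3.
have h5 : 0 <= slope * n1 / radius u by rewrite mulr_ge0// invr_ge0 ltW.
have hX : `|profile u - profile v| <= 4 * slope * n1 / radius u.
  by rewrite ler_norml; apply/andP; split; lra.
rewrite -[leLHS]real_normK ?num_real//; apply: lerXn2r => //; rewrite nnegrE ?normr_ge0//.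
exact: le_trans (normr_ge0 _) hX.
Qed.

End LogProfile.

(** * The test function and its energy *)

Section ClusterProfile.
Context {R : realType} (J : Z2 -> R) (r M : R) (N m : nat) (L : R).
Context (sh : Z2 -> Z2 -> bool) (Q : Z2 -> R).
Context (J_ge0 : forall x, 0 <= J x) (r_gt2 : 2 < r).
Context (moment_le : forall s, uniq s -> \sum_(x <- s) J x * (1 + (norm1 x)%:R) `^ r <= M).
Context (L_ge1 : 1 <= L) (L_lt : L < N%:R / 2) (m_le : 2 * m%:R <= L).
Context (sh_sym : forall u v, sh u v = sh v u).
Context (plen_le : forall u g, (norm1 u <= N)%N -> uniq (u :: g) -> path sh u g ->
  (plen u g <= m)%N).
Context (plen_sqr_le : forall u g, (norm1 u <= N)%N -> uniq (u :: g) -> path sh u g ->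
  (plen u g)%:R ^+ 2 <= Q u).

Local Notation phi := (profile N L).

(** Constant on clusters, hence admissible in [Eeff]. The set contains [phi u] and is bounded by 1,
    so [sup] is a genuine supremum. *)
Definition cluster_profile (u : Z2) : R := sup [set phi v | v in [set v | linked sh u v]].

Lemma cluster_profile_ge u v : linked sh u v -> phi v <= cluster_profile u.
Proof.
move=> uv; apply: ub_le_sup; last by exists v.
by exists 1 => _ [z _ <-]; exact: profile_le1.
Qed.

Lemma cluster_profile_le u c : (forall v, linked sh u v -> phi v <= c) -> cluster_profile u <= c.
Proof.
move=> h; apply: ge_sup; first by exists (phi u), u => //; exact: linked_refl.
by move=> _ [v uv <-]; exact: h.
Qed.

Lemma cluster_profile_shorted u v : sh u v -> cluster_profile u = cluster_profile v.
Proof.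
have le a b : sh a b -> cluster_profile a <= cluster_profile b.
  move=> ab; apply: cluster_profile_le => z az; apply: cluster_profile_ge.
  apply: linked_trans az; exists [:: a]; split => //=.
  by rewrite sh_sym ab.
move=> uv; apply/eqP; rewrite eq_le le// le//.
by rewrite sh_sym.
Qed.

Lemma cluster_profile_origin : cluster_profile origin = 1.
Proof.
apply/eqP; rewrite eq_le cluster_profile_le => [|v _]; last exact: profile_le1.
rewrite -(profile_origin N L_ge1); apply: cluster_profile_ge; exact: linked_refl.
Qed.

Lemma linked_short u v : (norm1 u <= N)%N -> linked sh u v ->
  (norm1 (zsub u v) <= m)%N /\ (norm1 (zsub u v))%:R ^+ 2 <= Q u.
Proof.
move=> uN [g [pg <-]]; have [g' [pg' ug' <-]] := path_uniq_connect pg.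
have h := plen_last u g'; split; first exact: leq_trans h (plen_le uN ug' pg').
by apply: le_trans (plen_sqr_le uN ug' pg'); apply: lerXn2r; rewrite ?nnegrE// ler_nat.
Qed.

Lemma half_leN (u : Z2) : (norm1 u)%:R < N%:R / 2 :> R -> (norm1 u <= N)%N.
Proof.
move=> h; rewrite -(ler_nat R); have : 0 <= N%:R :> R by []; lra.
Qed.

(** A vertex with positive profile lies within [N / 2], and its cluster reaches at most
    [m <= L / 2 < N / 4] further. The shorted path is read from that vertex, since lengths are
    controlled only for starts in the ball of radius [N]. *)
Lemma cluster_profile_eq0 u : (N <= norm1 u)%N -> cluster_profile u = 0.
Proof.
move=> uN; apply/eqP; rewrite eq_le; apply/andP; split; last first.
  by apply: le_trans (cluster_profile_ge (linked_refl sh u)); exact: profile_ge0.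
apply: cluster_profile_le => v uv.
have [h|h] := lerP (N%:R / 2 : R) (norm1 v)%:R; first by rewrite profile_eq0.
have [h1 _] := linked_short (half_leN h) (linked_sym sh_sym uv).
have h2 := norm1_le_zsub u v; rewrite norm1_zsubC in h2.
have h3 : (norm1 u <= m + norm1 v)%N by apply: leq_trans h2 _; rewrite leq_add2r.
have h4 : N%:R <= m%:R + (norm1 v)%:R :> R by rewrite -natrD ler_nat (leq_trans uN).
have := m_le; have := L_lt; have : 0 <= N%:R :> R by []; lra.
Qed.

Local Notation rho u := ((radius L u) ^+ 2)^-1.
Local Notation sl := (slope N L).

Lemma rho_ge0 u : 0 <= rho u.
Proof. by rewrite invr_ge0 exprn_ge0// ltW// radius_gt0. Qed.

Lemma short_le_L (k : nat) : (k <= m)%N -> 2 * k%:R <= L.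
Proof. move=> km; apply: le_trans m_le; rewrite ler_wpM2l// ler_nat//. Qed.

Lemma cluster_profile_close u : (norm1 u <= N)%N ->
  (cluster_profile u - phi u) ^+ 2 <= 16 * sl ^+ 2 * rho u * Q u.
Proof.
move=> uN; have c0 : 0 <= 16 * sl ^+ 2 * rho u.
  by rewrite mulr_ge0 ?rho_ge0// mulr_ge0 ?sqr_ge0.
have [_ Q0] := linked_short uN (linked_refl sh u).
have B0 : 0 <= 16 * sl ^+ 2 * rho u * Q u.
  by rewrite mulr_ge0//; apply: le_trans Q0; rewrite sqr_ge0.
have h0 : 0 <= cluster_profile u - phi u.
  by rewrite subr_ge0; apply: cluster_profile_ge; exact: linked_refl.
(* The square is traded for a root, so that the bound becomes one on each [phi v] and passes to the
   supremum. *)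
rewrite -[leRHS]sqr_sqrtr//; apply: lerXn2r; rewrite ?nnegrE ?sqrtr_ge0//.
rewrite lerBlDr; apply: cluster_profile_le => v uv; rewrite -lerBlDr.
have [h1 h2] := linked_short uN uv.
apply: le_trans (ler_norm _) _; rewrite -sqrtr_sqr; apply: ler_wsqrtr.
rewrite -sqrrN opprB.
apply: le_trans (profile_sqr_lip L_ge1 L_lt (short_le_L h1)) _.
by rewrite ler_wpM2l.
Qed.

(** The first term serves steps of length at most [m], through the Lipschitz bound; the second
    serves longer steps, where the profile changes by at most 1. *)
Definition step_bound (u : Z2) : R :=
  if (norm1 u <= N)%N then 16 * sl ^+ 2 * rho u + (1 + m%:R) `^ (- r) else 0.

Definition cluster_bound (u : Z2) : R :=
  if (norm1 u <= N)%N then 16 * sl ^+ 2 * rho u * Q u else 0.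

Lemma step_bound_ge0 u : 0 <= step_bound u.
Proof.
rewrite /step_bound; case: ifP => // _.
by rewrite addr_ge0 ?powR_ge0// mulr_ge0 ?rho_ge0// mulr_ge0 ?sqr_ge0.
Qed.

Lemma cluster_bound_spec u : (cluster_profile u - phi u) ^+ 2 <= cluster_bound u.
Proof.
rewrite /cluster_bound; case: leqP => h; first exact: cluster_profile_close.
rewrite cluster_profile_eq0 1?ltnW// profile_eq0// ?subrr ?expr0n//.
have : N%:R <= (norm1 u)%:R :> R by rewrite ler_nat ltnW.
have : 0 <= N%:R :> R by []; lra.
Qed.

Lemma cluster_bound_ge0 u : 0 <= cluster_bound u.
Proof. by apply: le_trans (cluster_bound_spec u); exact: sqr_ge0. Qed.

(** As [m < N / 4], the profile also vanishes within distance [m] of the exterior of the ball of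
    radius [N]. *)
Lemma phi_far u : (N < norm1 u + m)%N -> phi u = 0.
Proof.
move=> h; apply: profile_eq0 => //.
have : N%:R <= (norm1 u)%:R + m%:R :> R by rewrite -natrD ler_nat ltnW.
have := m_le; have := L_lt; have : 0 <= N%:R :> R by []; lra.
Qed.

Lemma profile_diff_le1 u v : (phi u - phi v) ^+ 2 <= 1.
Proof.
have u0 := profile_ge0 N L u; have u1 := profile_le1 L_ge1 L_lt u.
have v0 := profile_ge0 N L v; have v1 := profile_le1 L_ge1 L_lt v.
rewrite -[leLHS]real_normK ?num_real// -(expr1n _ 2); apply: lerXn2r; rewrite ?nnegrE//.
by rewrite ler_norml; apply/andP; split; lra.
Qed.

Lemma profile_step u v : (phi u - phi v) ^+ 2 <=
  (1 + (norm1 (zsub u v))%:R) `^ r * (step_bound u + step_bound v).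
Proof.
set p := _ `^ r; have p0 : 0 <= p := powR_ge0 _ _.
have su := step_bound_ge0 u; have sv := step_bound_ge0 v.
have [uv|uv] := leqP (norm1 (zsub u v)) m.
  have [uN|uN] := leqP (norm1 u) N; last first.
    rewrite (phi_far (ltn_addr _ uN)) phi_far; last first.
      by apply: leq_trans uN _; rewrite addnC; apply: leq_trans (norm1_le_zsub u v) _; rewrite leq_add2r.
    by rewrite subrr expr0n /= mulr_ge0// addr_ge0.
  apply: le_trans (profile_sqr_lip L_ge1 L_lt (short_le_L uv)) _.
  apply: (@le_trans _ _ (p * step_bound u)); last by rewrite ler_wpM2l// lerDl.
  rewrite /step_bound uN mulrC; apply: ler_pM.
  - by rewrite sqr_ge0.
  - by rewrite mulr_ge0 ?rho_ge0// mulr_ge0 ?sqr_ge0.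
  - exact: sqr_le_powR.
  - by rewrite lerDl powR_ge0.
(* For a step longer than [m] the weight [p] exceeds [(1 + m) ^ r], so the second term of
   [step_bound] alone covers a change of at most 1. *)
have h1 : 1 <= p * (1 + m%:R) `^ (- r).
  rewrite powRN ler_pdivlMr ?powR_gt0 ?ltr_wpDr// mul1r; apply: ge0_ler_powR; rewrite ?nnegrE ?addr_ge0//.
    by apply: ltW; apply: lt_trans r_gt2.
  by rewrite lerD2l ler_nat ltnW.
have h2 z : (norm1 z <= N)%N -> 1 <= p * step_bound z.
  move=> zN; apply: le_trans h1 _; rewrite ler_wpM2l// /step_bound zN lerDr.
  by rewrite mulr_ge0 ?rho_ge0// mulr_ge0 ?sqr_ge0.
rewrite mulrDr; have pu : 0 <= p * step_bound u by rewrite mulr_ge0.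
have pv : 0 <= p * step_bound v by rewrite mulr_ge0.
have [uN|uN] := leqP (norm1 u) N.
  by apply: le_trans (profile_diff_le1 u v) _; have := h2 u uN; lra.
have [vN|vN] := leqP (norm1 v) N.
  by apply: le_trans (profile_diff_le1 u v) _; have := h2 v vN; lra.
by rewrite (phi_far (ltn_addr m uN)) (phi_far (ltn_addr m vN)) subrr expr0n /= addr_ge0.
Qed.

(** The difference is that of [phi] plus the two errors of replacing [phi] by its supremum over the
    cluster; the square of three terms costs the factor 3. *)
Lemma cluster_profile_step u v : (cluster_profile u - cluster_profile v) ^+ 2 <=
  (1 + (norm1 (zsub u v))%:R) `^ r *
  (3 * (step_bound u + cluster_bound u) + 3 * (step_bound v + cluster_bound v)).
Proof.
have h1 := profile_step u v.
have h2 := cluster_bound_spec u; have h3 := cluster_bound_spec v.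
have u0 := cluster_bound_ge0 u; have v0 := cluster_bound_ge0 v.
have p1 : 1 <= (1 + (norm1 (zsub u v))%:R) `^ r.
  rewrite -[leLHS](powRr0 (1 + (norm1 (zsub u v))%:R)); apply: ler_powR.
    by rewrite lerDl.
  by apply: ltW; apply: lt_trans r_gt2.
move: (_ `^ r) h1 p1 => p h1 p1.
have h4 : cluster_bound u + cluster_bound v <= p * (cluster_bound u + cluster_bound v).
  by rewrite -[leLHS]mul1r ler_wpM2r// addr_ge0.
set a := phi u - phi v in h1; set b := cluster_profile u - phi u in h2.
set c := cluster_profile v - phi v in h3.
have -> : cluster_profile u - cluster_profile v = a + b - c by rewrite /a /b /c; ring.
have h5 : (a + b - c) ^+ 2 <= 3 * (a ^+ 2 + b ^+ 2 + c ^+ 2).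
  have := sqr_ge0 (a - b); have := sqr_ge0 (a + c); have := sqr_ge0 (b + c).
  by rewrite !expr2; nra.
lra.
Qed.

(** Each pair is charged to its two endpoints. Summing over the other endpoint yields the moment
    [M], so each side gives [3 * M] and the prefactor 1/2 of the energy halves the total [6 * M]. *)
Lemma cluster_profile_energy :
  (energy J sh cluster_profile <=
   (3 * M * \sum_(u <- ball N) (step_bound u + cluster_bound u))%:E)%E.
Proof.
pose a u := step_bound u + cluster_bound u.
have a0 u : 0 <= a u by rewrite addr_ge0 ?step_bound_ge0 ?cluster_bound_ge0.
have M0 : 0 <= M by have := moment_le (s := [::]) isT; rewrite big_nil.
pose Jr x := J x * (1 + (norm1 x)%:R) `^ r.
have Jr0 x : 0 <= Jr x by rewrite mulr_ge0 ?powR_ge0.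
have aV V : uniq V -> \sum_(u <- V) a u <= \sum_(u <- ball N) a u.
  move=> uV; rewrite (bigID (fun u => norm1 u <= N)%N) /= [X in _ + X]big1 ?addr0; last first.
    by move=> u /negbTE h; rewrite /a /step_bound /cluster_bound h addr0.
  rewrite -big_filter; apply: ler_sum_subset => //; first exact: filter_uniq.
  by move=> u; rewrite mem_filter mem_ball => /andP[].
have E : (\esum_(p in [set p : Z2 * Z2 | p.1 != p.2 /\ ~~ sh p.1 p.2])
    (J (zsub p.1 p.2) * (cluster_profile p.1 - cluster_profile p.2) ^+ 2)%:E <=
    (6 * M * \sum_(u <- ball N) a u)%:E)%E.
  apply: ge_ereal_sup => _ [A [fA _] <-].
  rewrite fsbig_finite//= sumEFin lee_fin.
  have := finmap.fset_uniq (fset_set A); move: (finmap.enum_fset _) => S uS.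
  (* A finite set of pairs is enlarged to the square of its set of endpoints, so that one endpoint
     can be summed with the other fixed. *)
  pose V := undup ([seq p.1 | p <- S] ++ [seq p.2 | p <- S]).
  have uV : uniq V by exact: undup_uniq.
  pose F (p : Z2 * Z2) := Jr (zsub p.1 p.2) * (3 * a p.1 + 3 * a p.2).
  have F0 p : 0 <= F p by rewrite mulr_ge0// addr_ge0// mulr_ge0.
  apply: (@le_trans _ _ (\sum_(p <- S) F p)).
    apply: ler_sum => p _; rewrite /F /Jr -mulrA ler_wpM2l//; exact: cluster_profile_step.
  apply: (@le_trans _ _ (\sum_(p <- [seq (u, v) | u <- V, v <- V]) F p)).
    apply: ler_sum_subset => // -[u v] uvS; apply/allpairsP; exists (u, v).
    split => //=; rewrite mem_undup mem_cat; apply/orP; [left|right]; apply/mapP; by exists (u, v).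
  rewrite big_allpairs_dep /= /F /=.
  under eq_bigr do under eq_bigr do rewrite mulrDr.
  under eq_bigr do rewrite big_split /=.
  rewrite big_split /= [X in _ + X]exchange_big /=.
  have -> : 6 * M * \sum_(u <- ball N) a u = 3 * M * (\sum_(u <- ball N) a u) + 3 * M * (\sum_(u <- ball N) a u) by ring.
  (* [f] stands for the difference with either its first or its second argument fixed. *)
  have key (f : Z2 -> Z2 -> Z2) : (forall u, injective (f u)) ->
      \sum_(u <- V) \sum_(v <- V) Jr (f u v) * (3 * a u) <= 3 * M * (\sum_(u <- ball N) a u).
    move=> finj; apply: (@le_trans _ _ (3 * M * \sum_(u <- V) a u)); last first.
      by rewrite ler_wpM2l ?aV// mulr_ge0.
    rewrite mulr_sumr; apply: ler_sum => u _; rewrite -mulr_suml.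
    have -> : 3 * M * a u = M * (3 * a u) by ring.
    rewrite ler_wpM2r ?mulr_ge0//.
    rewrite -(big_map (f u) xpredT Jr); apply: moment_le.
    by rewrite map_inj_uniq//; exact: finj.
  by apply: lerD; [apply: key; exact: zsub_injl|apply: (key (fun v u => zsub u v)); exact: zsub_injr].
rewrite /energy; apply: le_trans (lee_wpmul2l _ E) _; first by rewrite lee_fin invr_ge0.
by rewrite -EFinM lee_fin; rewrite le_eqVlt; apply/orP; left; apply/eqP; field.
Qed.

End ClusterProfile.

Lemma eresistance_ge (R : realType) (J : Z2 -> R) (sh : Z2 -> Z2 -> bool) (a b : Z2) (E : R) :
  (forall x, 0 <= J x) -> 0 < E -> (Eeff J sh a b <= E%:E)%E ->
  ((E^-1)%:E <= eresistance J sh a b)%E.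
Proof.
move=> J0 E0 EE; have : (0 <= Eeff J sh a b)%E.
  apply: le_ereal_inf_tmp => _ [g _ <-]; rewrite /energy mule_ge0 ?lee_fin ?invr_ge0//.
  by apply: esum_ge0 => p _; rewrite lee_fin mulr_ge0 ?sqr_ge0.
(* The value [+oo] is excluded by the upper bound and [-oo] by positivity; at energy 0 the
   resistance is [+oo]. *)
rewrite /eresistance; case: (Eeff J sh a b) EE => [x| |] //=.
rewrite !lee_fin => xE x0; case: eqVneq => [_|xn]; first by rewrite leey.
by rewrite lee_fin lef_pV2 ?posrE// lt_neqAle eq_sym xn.
Qed.

(** * The scales as powers of [N] *)

Section Scales.
Context {R : realType} (r : R) (N : nat).
Local Notation X := (N%:R : R).
Local Notation s := (r - 2).
Local Notation delta := (s / (4 * r)).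

Lemma ge2_natr_neq0 : (2 <= N)%N -> X != 0.
Proof. by rewrite pnatr_eq0; lia. Qed.

(** [delta] is the solution of [2 - (1 - 2 * delta) * r = - s / 2]: the ball has at most [9 * N ^ 2]
    vertices, and the tail of one vertex beats this number. *)
Lemma long_scale (m : nat) : 2 < r -> (2 <= N)%N -> X `^ (1 - 2 * delta) <= 1 + m%:R ->
  (size (ball N))%:R * (1 + m%:R) `^ (- r) <= 9 * X `^ (- (s / 2)).
Proof.
move=> r2 N2 hm; have X0 := ge2_natr_neq0 N2.
have r0 : 0 <= r by lra.
have -> : - (s / 2) = 2%:R + (1 - 2 * delta) * (- r) by field; apply/eqP; lra.
rewrite powRD ?X0 ?implybT// mulrA; apply: ler_pM; rewrite ?powR_ge0//.
  rewrite powR_mulrn//.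
  apply: (@le_trans _ _ ((2 * N + 1) ^ 2)%:R); first by rewrite ler_nat size_ball.
  by rewrite -natrX -natrM ler_nat; nia.
rewrite powRrM !powRN lef_pV2 ?posrE ?powR_gt0 ?ltr_wpDr ?ltr0n//; last by lia.
by apply: ge0_ler_powR; rewrite ?nnegrE ?powR_ge0 ?addr_ge0.
Qed.

(** The variance factor is at most [25 * n ^ 6], hence the exponent 1/12, which makes
    [n ^ 6 <= N ^ (1 / 2)]; as [delta <= 1 / 4], the weight is at most [N ^ (- 3 / 2)]. *)
Lemma short_scale (n : nat) : 2 < r -> r <= 3 -> (2 <= N)%N -> n%:R <= X `^ (12^-1) ->
  (n%:R ^+ 2) ^+ 2 * ((size (ball (2 * n)))%:R * ((X `^ (1 - delta)) ^+ 2)^-1) <= 25 * X^-1.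
Proof.
move=> r2 r3 N2 hn; have X0 := ge2_natr_neq0 N2.
have X1 : 1 <= X by rewrite ler1n; lia.
have d4 : delta <= 4^-1 by rewrite ler_pdivrMr; lra.
have h1 : (n%:R ^+ 2) ^+ 2 * (size (ball (2 * n)))%:R <= 25 * n%:R ^+ 6 :> R.
  apply: (@le_trans _ _ ((n%:R ^+ 2) ^+ 2 * ((2 * (2 * n) + 1) ^ 2)%:R)).
    by rewrite ler_wpM2l ?sqr_ge0// ler_nat size_ball.
  rewrite -!natrX -!natrM ler_nat; case: n {hn} => [//|n]; nia.
have h2 : n%:R ^+ 6 <= X `^ (2^-1) :> R.
  have -> : 2^-1 = 12^-1 * 6%:R :> R by field.
  by rewrite powRrM powR_mulrn ?powR_ge0//; apply: lerXn2r; rewrite ?nnegrE ?powR_ge0.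
have h3 : ((X `^ (1 - delta)) ^+ 2)^-1 = X `^ (- (2 * (1 - delta))).
  by rewrite powRN [2 * _]mulrC powRrM powR_mulrn ?powR_ge0.
rewrite mulrA h3; apply: le_trans (ler_wpM2r (powR_ge0 _ _) h1) _.
rewrite -mulrA ler_pM2l//; apply: le_trans (ler_wpM2r (powR_ge0 _ _) h2) _.
rewrite -powRD ?X0 ?implybT// -[X^-1]powR_inv1//; apply: ler_powR => //; lra.
Qed.

Lemma mid_scale (n : nat) : 2 < r -> (2 <= N)%N -> X `^ (12^-1) <= 1 + n%:R ->
  (1 + n%:R) `^ (2 - r) <= X `^ (- (s / 12)).
Proof.
move=> r2 N2 hn; have -> : 2 - r = - s by ring.
rewrite !powRN lef_pV2 ?posrE ?powR_gt0 ?ltr_wpDr ?ltr0n//; last by lia.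
rewrite [s / 12]mulrC powRrM; have s0 : 0 <= s by rewrite subr_ge0 ltW.
by apply: (ge0_ler_powR s0); rewrite ?nnegrE ?powR_ge0 ?addr_ge0.
Qed.

(** The slope is the inverse of [delta * ln N - ln 2], and [4 <= N ^ delta] makes [ln 2] at most
    half of [delta * ln N]. *)
Lemma slope_scale : 2 < r -> (2 <= N)%N -> 4 <= X `^ delta ->
  slope N (X `^ (1 - delta)) <= 2 / delta / ln X.
Proof.
move=> r2 N2 h4; have X0 : 0 < X by rewrite ltr0n; lia.
have d0 : 0 < delta by rewrite divr_gt0; lra.
have l2 := ln2_ge R.
have lX : 0 < ln X by apply: ln_gt0; rewrite ltr1n.
have h : ln 2 + ln 2 <= delta * ln X.
  rewrite -ln_powR -lnM ?posrE// ler_ln ?posrE ?powR_gt0//; lra.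
have -> : 2 / delta / ln X = (delta * ln X / 2)^-1 by field; rewrite !gt_eqF//=; lra.
rewrite /slope ln_powR ln_div ?posrE//.
have p0 : 0 < delta * ln X by rewrite mulr_gt0.
rewrite lef_pV2 ?posrE; lra.
Qed.

End Scales.

(** * The good event and the resistance on it *)

Section LargeScale.
Context {R : realType} {J : Z2 -> R} {eps : R} (r : R) (N : nat).
Context {d : measure_display} {T : measurableType d} {P : probability T R}.
Context {xi : Z2 -> Z2 -> T -> bool} (hxi : RRN J eps P xi).
Context (J_sym : forall x, J x = J (zopp x)) (J_ge0 : forall x, 0 <= J x).
Context (eps_ge0 : 0 <= eps) (r_gt2 : 2 < r) (r_le3 : r <= 3).
Context (eps_moment_le : forall s, uniq s ->
  \sum_(x <- s) eps * J x * (1 + (norm1 x)%:R) `^ r <= 2^-1).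
Local Notation X := (N%:R : R).
Local Notation s := (r - 2).
Local Notation delta := (s / (4 * r)).
Context (N_ge2 : (2 <= N)%N) (N_large : 4 <= X `^ delta).

Local Notation L := (X `^ (1 - delta)).
Local Notation m := (Num.truncn (X `^ (1 - 2 * delta))).
Local Notation n := (Num.truncn (X `^ (12^-1))).
Local Notation c u := ((radius L u ^+ 2)^-1).
Local Notation cfg := (config (xi := xi)).

(** The mean of the short sum is at most twice the sum of the weights, by [Ex_short_max]; the
    allowed excess [ln X] has the order of that sum itself. *)
Definition good_event : set T := ~` (long_open (xi := xi) N m `|`
  ([set w | (2 * (\sum_(u <- ball N) c u) + ln X <=
      \sum_(u <- ball N) c u * short_max n u (cfg w))%R] `|`
   [set w | (ln X <= \sum_(u <- ball N) c u * mid_sum n m u (cfg w))%R])).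

Let X_ge1 : 1 <= X. Proof. by rewrite ler1n; lia. Qed.
Let X_gt0 : 0 < X. Proof. by rewrite ltr0n; lia. Qed.
Let delta_gt0 : 0 < delta. Proof. by have := r_gt2; move=> h; rewrite divr_gt0; lra. Qed.
Let delta_lt : delta <= 4^-1. Proof. by have := r_gt2; move=> h; rewrite ler_pdivrMr; lra. Qed.

Let lnX_gt0 : 0 < ln X. Proof. by rewrite ln_gt0// ltr1n. Qed.

Let lnX_ge : 2^-1 <= ln X.
Proof. by apply: le_trans (ln2_ge R) _; rewrite ler_ln ?posrE// ler_nat. Qed.

Let L_ge1 : 1 <= L.
Proof.
rewrite -[leLHS](powRr0 X); apply: ler_powR => //; have := delta_lt; lra.
Qed.

Let L_lt : L < X / 2.
Proof.
have h : X = L * X `^ delta.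
  by rewrite -powRD ?(gt_eqF X_gt0) ?implybT// subrK powRr1// ltW.
have L0 : 0 < L := lt_le_trans ltr01 L_ge1.
have := ler_wpM2l (ltW L0) N_large; rewrite -h => h4.
rewrite ltr_pdivlMr//; lra.
Qed.

Let m_bounds : m%:R <= X `^ (1 - 2 * delta) /\ X `^ (1 - 2 * delta) <= 1 + m%:R.
Proof.
have /andP[h1 h2] := truncn_itv (powR_ge0 X (1 - 2 * delta)).
by split => //; rewrite nat1r; exact: ltW.
Qed.

Let n_bounds : n%:R <= X `^ (12^-1) /\ X `^ (12^-1) <= 1 + n%:R.
Proof.
have /andP[h1 h2] := truncn_itv (powR_ge0 X (12^-1)).
by split => //; rewrite nat1r; exact: ltW.
Qed.

Let m_le : 2 * m%:R <= L.
Proof.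
have [h1 _] := m_bounds.
have -> : L = X `^ (1 - 2 * delta) * X `^ delta.
  by rewrite -powRD ?(gt_eqF X_gt0) ?implybT//; congr powR; ring.
have h := ler_wpM2l (powR_ge0 X (1 - 2 * delta)) N_large.
have := powR_ge0 X (1 - 2 * delta); lra.
Qed.

Let c_ge0 u : 0 <= c u.
Proof. by rewrite invr_ge0 sqr_ge0. Qed.

Let sum_c : \sum_(u <- ball N) c u <= 32 * ln X.
Proof. exact: sum_weight_le. Qed.

Lemma measurable_good_event : measurable good_event.
Proof.
apply: measurableC; apply: measurableU.
  by have [] := long_open_prob hxi J_sym J_ge0 eps_ge0 r_gt2 eps_moment_le N m.
apply: measurableU; apply: bounded_rv_lt; apply: bounded_rv_sum => u; apply: bounded_rvM.
- exact: bounded_rv_cst.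
- exact: (bounded_short_max hxi).
- exact: bounded_rv_cst.
- exact: (bounded_mid_sum hxi).
Qed.

(** [1682 = 18 + 1600 + 64], for the long, short and middle paths; of the exponents [- s / 2], [- 1]
    and [- s / 12] the last is the weakest. *)
Lemma good_event_prob : ((1 - 1682 * X `^ (- (s / 12)))%:E <= P good_event)%E.
Proof.
have [mB0 B0] := long_open_prob hxi J_sym J_ge0 eps_ge0 r_gt2 eps_moment_le N m.
have c_le u : 0 <= c u <= (L ^+ 2)^-1.
  rewrite c_ge0 lef_pV2 ?posrE ?exprn_gt0 ?radius_gt0//; last exact: lt_le_trans L_ge1.
  by apply: lerXn2r; rewrite ?nnegrE ?powR_ge0 ?radius_geL// ltW// radius_gt0.
have B1 := short_sum_prob hxi J_sym J_ge0 eps_ge0 r_gt2 eps_moment_le n c_le sum_c lnX_gt0.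
have B2 := mid_sum_prob hxi J_sym J_ge0 eps_ge0 r_gt2 eps_moment_le n m c_ge0 sum_c lnX_gt0.
have X12 : 0 <= X `^ (- (s / 12)) by exact: powR_ge0.
have E0 : (size (ball N))%:R * (2 * (1 + m%:R) `^ (- r)) <= 18 * X `^ (- (s / 12)).
  have h := long_scale r_gt2 N_ge2 (proj2 m_bounds).
  have h2 : X `^ (- (s / 2)) <= X `^ (- (s / 12)).
    by apply: ler_powR => //; have := r_gt2; lra.
  rewrite mulrCA; lra.
have E1 : (n%:R ^+ 2) ^+ 2 * (32 * ln X * ((size (ball (2 * n)))%:R * (L ^+ 2)^-1)) / ln X ^+ 2
    <= 1600 * X `^ (- (s / 12)).
  have h := short_scale r_gt2 r_le3 N_ge2 (proj1 n_bounds).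
  have h2 : X^-1 <= X `^ (- (s / 12)).
    have -> : X^-1 = X `^ (-1) by rewrite powR_inv1// ltW.
    by apply: ler_powR => //; have := r_le3; lra.
  set a := _ ^+ 2 in h *; set b := _ * _^-1 in h *.
  have -> : a * (32 * ln X * b) / ln X ^+ 2 = (a * b) * (32 / ln X) by field; rewrite gt_eqF.
  (* Here [1600 = 25 * 64], with 25 from [short_scale]. *)
  have l2 : 32 / ln X <= 64 by rewrite ler_pdivrMr//; have := lnX_ge; lra.
  apply: le_trans (ler_wpM2r _ h) _; first by rewrite divr_ge0// ltW.
  apply: le_trans (ler_wpM2l _ l2) _; first by rewrite mulr_ge0// invr_ge0.
  lra.
have E2 : 32 * ln X * (2 * (1 + n%:R) `^ (2 - r)) / ln X <= 64 * X `^ (- (s / 12)).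
  have h := mid_scale r_gt2 N_ge2 (proj2 n_bounds).
  have -> : 32 * ln X * (2 * (1 + n%:R) `^ (2 - r)) / ln X = 64 * (1 + n%:R) `^ (2 - r) by field; rewrite gt_eqF.
  by rewrite ler_pM2l.
have mg := measurable_good_event; rewrite /good_event in mg *.
have mB := measurableC mg; rewrite setCK in mB.
rewrite probability_setC//; set B := (X in P X) in mB *.
have PB : (P B <= (1682 * X `^ (- (s / 12)))%:E)%E.
  have -> : 1682 * X `^ (- (s / 12)) = 18 * X `^ (- (s / 12)) + (1600 * X `^ (- (s / 12)) + 64 * X `^ (- (s / 12))) by ring.
  have mB1 : measurable [set w | (2 * (\sum_(u <- ball N) c u) + ln X <= \sum_(u <- ball N) c u * short_max n u (cfg w))%R].
    apply: bounded_rv_lt; apply: bounded_rv_sum => u; apply: bounded_rvM; [exact: bounded_rv_cst|exact: (bounded_short_max hxi)].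
  have mB2 : measurable [set w | (ln X <= \sum_(u <- ball N) c u * mid_sum n m u (cfg w))%R].
    apply: bounded_rv_lt; apply: bounded_rv_sum => u; apply: bounded_rvM; [exact: bounded_rv_cst|exact: (bounded_mid_sum hxi)].
  rewrite /B !EFinD; apply: le_trans (measureU2 _ _ _) _ => //; first exact: measurableU.
  apply: leeD; first by apply: le_trans B0 _; rewrite lee_fin.
  apply: le_trans (measureU2 _ _ _) _ => //; apply: leeD.
    by apply: le_trans B1 _; rewrite lee_fin.
  by apply: le_trans B2 _; rewrite lee_fin.
by rewrite EFinB leeB.
Qed.

Context (M : R) (M_gt0 : 0 < M).
Context (moment_le : forall s, uniq s -> \sum_(x <- s) J x * (1 + (norm1 x)%:R) `^ r <= M).

(** The squared slope is [O(1 / (ln N) ^ 2)] and the weighted sums are [O(ln N)], so the energy is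
    [O(1 / ln N)]; the contribution of the long steps is polynomially small. *)
Lemma good_event_resistance w x : good_event w -> norminf x = N ->
  (((3 * M * (98 * 64 / delta ^+ 2 + 18 / s))^-1 * ln X)%:E <=
   eresistance J (fun u v => xi u v w) origin x)%E.
Proof.
move=> gw xN.
have [h0 h1 h2] : [/\ ~ long_open (xi := xi) N m w,
    \sum_(u <- ball N) c u * short_max n u (cfg w) < 2 * (\sum_(u <- ball N) c u) + ln X &
    \sum_(u <- ball N) c u * mid_sum n m u (cfg w) < ln X].
  split; first by move=> h; apply: gw; left.
    by rewrite ltNge; apply/negP => h; apply: gw; right; left.
  by rewrite ltNge; apply/negP => h; apply: gw; right; right.
pose sh u v := xi u v w.
have sh_sym u v : sh u v = sh v u by rewrite /sh; case: hxi => ->.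
have shE u g : path sh u g = all (cfg w) (pedges u g) by exact: path_pedges.
have plen_le u g : (norm1 u <= N)%N -> uniq (u :: g) -> path sh u g -> (plen u g <= m)%N.
  move=> uN ug pg; rewrite leqNgt; apply/negP => mp; apply: h0; exists (u, g) => //=.
  by rewrite /long_path /= mem_ball uN mp -shE pg; move: ug => /= ->.
(* On the good event a shorted path from the ball has length at most [m], so it is counted in one of
   the two terms. *)
pose Q u := short_max n u (cfg w) + mid_sum n m u (cfg w) : R.
have plen_sqr_le u g : (norm1 u <= N)%N -> uniq (u :: g) -> path sh u g ->
    (plen u g)%:R ^+ 2 <= Q u.
  move=> uN ug pg; have pm := plen_le u g uN ug pg; have pg' := pg; rewrite shE in pg'.
  have [pn|pn] := leqP (plen u g) n.
    by apply: le_trans (short_max_ge ug pn pg') _; rewrite lerDl mid_sum_ge0.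
  apply: (@le_trans _ _ (mid_sum n m u (cfg w))); last by rewrite lerDr short_max_ge0.
  by apply: mid_sum_ge => //; rewrite pn pm.
have EE := cluster_profile_energy J_ge0 r_gt2 moment_le L_ge1 L_lt m_le sh_sym plen_le plen_sqr_le.
(* 98 = 32 + 65 + 1 bounds the sum of the weights and of both path sums, in units of
   [ln X]; 64 = 16 * 2 ^+ 2 comes from [profile_sqr_lip] and [slope_scale]. *)
set K := 98 * 64 / delta ^+ 2 + 18 / s.
have s0 : 0 < s by rewrite subr_gt0.
have K0 : 0 < K.
  apply: addr_gt0; last exact: divr_gt0.
  by apply: divr_gt0; [exact: mulr_gt0|exact: exprn_gt0].
have sl0 := slope_gt0 L_ge1 L_lt.
have bound : \sum_(u <- ball N) (step_bound r N m L u + cluster_bound N L Q u) <= K / ln X.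
  have -> : \sum_(u <- ball N) (step_bound r N m L u + cluster_bound N L Q u) =
    16 * slope N L ^+ 2 * (\sum_(u <- ball N) c u + (\sum_(u <- ball N) c u * short_max n u (cfg w) +
       \sum_(u <- ball N) c u * mid_sum n m u (cfg w))) + (size (ball N))%:R * (1 + m%:R) `^ (- r).
    have -> a : (size (ball N))%:R * a = \sum_(u <- ball N) a :> R.
      by rewrite big_const_seq count_predT iter_addr_0 mulr_natl.
    rewrite -!big_split /= mulr_sumr -big_split /=; apply: eq_big_seq => u; rewrite mem_ball => uN.
    by rewrite /step_bound /cluster_bound uN /Q; ring.
  have t1 := long_scale r_gt2 N_ge2 (proj2 m_bounds).
  (* From [ln y < y] at [y = X ^ (s / 2)]; with the factor 9 of [long_scale] this gives the term
     [18 / s] of [K]. *)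
  have t2 : X `^ (- (s / 2)) <= 2 / s / ln X.
    have -> : 2 / s / ln X = (s / 2 * ln X)^-1 by field; rewrite !gt_eqF.
    have l0 : 0 < s / 2 * ln X by rewrite mulr_gt0// divr_gt0.
    rewrite powRN lef_pV2 ?posrE ?powR_gt0//.
    by rewrite -ln_powR; apply: ltW; apply: ln_sublinear; rewrite powR_gt0.
  have t3 := slope_scale r_gt2 N_ge2 N_large.
  have t4 : slope N L ^+ 2 <= (2 / delta / ln X) ^+ 2.
    apply: lerXn2r => //; rewrite nnegrE; apply: ltW => //.
    by apply: divr_gt0 => //; exact: divr_gt0.
  have t5 : \sum_(u <- ball N) c u + (\sum_(u <- ball N) c u * short_max n u (cfg w) +
       \sum_(u <- ball N) c u * mid_sum n m u (cfg w)) <= 98 * ln X by have := sum_c; lra.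
  have t6 : 16 * slope N L ^+ 2 * (98 * ln X) <= 16 * (2 / delta / ln X) ^+ 2 * (98 * ln X).
    by rewrite ler_wpM2r ?ler_pM2l// mulr_ge0// ltW.
  have t7 := ler_wpM2l (mulr_ge0 (ler0n R 16) (sqr_ge0 (slope N L))) t5.
  rewrite /K mulrDl.
  have e1 : 16 * (2 / delta / ln X) ^+ 2 * (98 * ln X) = 98 * 64 / delta ^+ 2 / ln X.
    move: (gt_eqF delta_gt0) (gt_eqF lnX_gt0); move: delta (ln X) => a b a0 b0.
    by field; rewrite a0 b0.
  have e2 : 18 / s / ln X = 9 * (2 / s / ln X) by field; rewrite !gt_eqF.
  lra.
have -> : (3 * M * K)^-1 * ln X = (3 * M * (K / ln X))^-1.
  by field; rewrite !gt_eqF.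
apply: eresistance_ge => //; first by rewrite !mulr_gt0// invr_gt0.
apply: le_trans (_ : energy J sh (cluster_profile N L sh) <= _)%E.
  apply: ereal_inf_lbound; exists (cluster_profile N L sh) => //; split.
    exact: (cluster_profile_origin sh L_ge1 L_lt).
  split; last by move=> u v; exact: cluster_profile_shorted.
  (* The test function vanishes at [x], whose l1 norm is at least its sup norm [N]. *)
  by apply: (cluster_profile_eq0 L_ge1 L_lt m_le sh_sym plen_le plen_sqr_le); rewrite -xN norminf_le_norm1.
by apply: le_trans EE _; rewrite lee_fin ler_wpM2l// mulr_ge0// ltW.
Qed.

End LargeScale.

(** * Choice of the constants, and the range of small [x] *)

Unset Implicit Arguments.

Theorem theorem2 (R : realType) (J : Z2 -> R) :
  coupling J -> A1 J ->
  exists eps0 : R, 0 < eps0 /\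
  forall eps : R, 0 < eps -> eps < eps0 ->
  exists (C kappa ct : R), 0 < kappa /\ 0 < ct /\
  forall (d : measure_display) (T : measurableType d) (P : probability T R)
         (xi : Z2 -> Z2 -> T -> bool),
    RRN J eps P xi ->
    forall x : Z2, (2 <= norminf x)%N ->
    exists A : set T, measurable A /\
      A `<=` [set w | ((ct * ln (norminf x)%:R)%:E
                        <= eresistance J (fun u v => xi u v w) origin x)%E] /\
      ((1 - C / ((norminf x)%:R `^ kappa))%:E <= P A)%E.
Proof.
move=> cJ a1; have [r [M [r2 r3 M0 mom]]] := A1_moment cJ a1.
have [Jsym [J0 _]] := cJ.
(* Below this value the weighted moment of [eps * J] is at most 1/2, as the path sums require. *)
exists (2 * M)^-1; split; first by rewrite invr_gt0 mulr_gt0.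
move=> eps e0 elt.
have emom s : uniq s -> \sum_(x <- s) eps * J x * (1 + (norm1 x)%:R) `^ r <= 2^-1.
  move=> us; under eq_bigr do rewrite -mulrA.
  rewrite -mulr_sumr; apply: le_trans (ler_wpM2l (ltW e0) (mom s us)) _.
  apply: le_trans (ler_wpM2r (ltW M0) (ltW elt)) _.
  by rewrite invfM mulfVK ?gt_eqF.
pose delta := (r - 2) / (4 * r).
pose kappa := (r - 2) / 12.
have s0 : 0 < r - 2 by rewrite subr_gt0.
have d0 : 0 < delta by rewrite divr_gt0// mulr_gt0//; exact: lt_trans r2.
have k0 : 0 < kappa by rewrite divr_gt0.
pose ct := (3 * M * (98 * 64 / delta ^+ 2 + 18 / (r - 2)))^-1.
have c4 : 0 <= 4 `^ (kappa / delta) := powR_ge0 _ _.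
(* 1682 comes from [good_event_prob]; the other term makes the claimed lower bound nonpositive when
   [N ^ delta < 4], where the empty event suffices. *)
exists (4 `^ (kappa / delta) + 1682), kappa, ct; split => //; split.
  rewrite invr_gt0; apply: mulr_gt0; first exact: mulr_gt0.
  apply: addr_gt0; last exact: divr_gt0.
  by apply: divr_gt0; [exact: mulr_gt0|exact: exprn_gt0].
move=> d T P xi hxi x x2.
set N := norminf x.
have N0 : 0 < N%:R :> R by rewrite ltr0n; lia.
have Nk : 0 < N%:R `^ kappa :> R by rewrite powR_gt0.
have [small|large] := ltP (N%:R `^ delta) (4 : R).
  exists set0; split => //; split => //.
  rewrite measure0 lee_fin subr_le0 ler_pdivlMr// mul1r.
  have -> : N%:R `^ kappa = (N%:R `^ delta) `^ (kappa / delta) :> R.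
    by rewrite -powRrM mulrCA divff ?mulr1// gt_eqF.
  apply: (@le_trans _ _ (4 `^ (kappa / delta))); last by rewrite lerDl ler0n.
  apply: ge0_ler_powR; rewrite ?nnegrE ?powR_ge0//; last exact: ltW.
  by rewrite ltW// divr_gt0.
exists (good_event (xi := xi) r N); split.
  exact: (measurable_good_event N hxi Jsym J0 (ltW e0) r2 emom).
split.
  by move=> w gw; exact: (good_event_resistance hxi J0 (ltW e0) r2 r3 x2 large M0 mom gw).
apply: le_trans (good_event_prob hxi Jsym J0 (ltW e0) r2 r3 emom x2 large).
rewrite lee_fin powRN lerD2l lerN2; apply: ler_wpM2r; first by rewrite invr_ge0 ltW.
by rewrite lerDr c4.
Qed.
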